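(* Let $\Gamma$ be a metric graph, let $e$ be an edge segment of $\Gamma$ with endpoints $\partial e=\{e^-,e^+\}$, and let $x,y,z\in\Gamma$. Then $$ j_z(x,y;\Gamma/e)=j_z(x,y;\Gamma)-\frac{\xi(x,z,e^-,e^+;\Gamma)\,\xi(y,z,e^-,e^+;\Gamma)}{r(e^-,e^+;\Gamma)}\,. $$
   Context: A metric graph $\Gamma$ is a compact connected metric space, not reduced to a point, such that every point has a neighborhood isometric to a star-shaped set, endowed with the path metric. A branch point is a point of valency different from $2$. A vertex set of $\Gamma$ is a finite set $V\subset\Gamma$ containing all branch points such that the closure of each connected component of $\Gamma\setminus V$ is isometric with a closed interval. An edge segment $e$ of $\Gamma$ is the closure of a connected component of $\Gamma\setminus V$ for some vertex set $V$; its two boundary points are denoted $\partial e=\{e^-,e^+\}\subset V$. $\Gamma/e$ is the quotient metric graph obtained by collapsing $e$ to a single point (all other lengths being kept). Points of $\Gamma$ are regarded on $\Gamma/e$ via their images under the quotient map. If $\Gamma/e$ is a single point, the definitions below still apply and give identically zero functions. $\mathrm{PL}(\Gamma)$ is the real vector space of continuous piecewise affine real-valued functions on $\Gamma$ with finitely many changes of slope. For $\phi\in \mathrm{PL}(\Gamma)$, $\Delta(\phi)=\sum_{p\in\Gamma}\sigma_p(\phi)\delta_p$, where $\delta_p$ is the Dirac measure at $p$ and $\sigma_p(\phi)$ is the sum of the incoming slopes of $\phi$ at $p$ over all tangent directions (i.e. minus the sum of the outgoing directional derivatives). For $y,z\in\Gamma$, $j_z(\cdot,y;\Gamma)$ is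 the unique function in $\mathrm{PL}(\Gamma)$ with $\Delta(j_z(\cdot,y;\Gamma))=\delta_y-\delta_z$ and $j_z(z,y;\Gamma)=0$. The effective resistance is $r(x,y;\Gamma)=j_y(x,x;\Gamma)=j_x(y,y;\Gamma)$. The cross ratio is $\xi(x,y,z,w;\Gamma)=j_q(x,z;\Gamma)+j_q(y,w;\Gamma)-j_q(x,w;\Gamma)-j_q(y,z;\Gamma)$ for any $q\in\Gamma$; it is independent of $q$.
   Formalization: The formula fails for points inside e (Γ=e=[0,1], z=0, x=y=1/2: 0 versus 1/4), so it is proved under the exact condition for its validity: x=z, or y=z, or z and at least one of x, y are not interior points of e. *)

(* Defs.v *)
(* Metric spaces are the metricType R of MathComp-Analysis, R any realType. *)
From HB Require Import structures.
From mathcomp Require Import all_boot all_order all_algebra generic_quotient.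
From mathcomp Require Import lra.
From mathcomp Require Import all_classical all_reals all_analysis.

Set Implicit Arguments.
Unset Strict Implicit.
Unset Printing Implicit Defensive.

Import Order.TTheory GRing.Theory Num.Theory.
Import numFieldNormedType.Exports.

Local Open Scope classical_set_scope.
Local Open Scope quotient_scope.
Local Open Scope ring_scope.

(* All notions up to cross_ratio are stated for an arbitrary metric space, so
   that they apply to Gamma/e even when it is reduced to a point. *)
Section LengthMetric.
Context {R : realType} {X : metricType R}.
Implicit Types (A : set X) (g : R -> X).

(* The supremum, over the subdivisions 0 < s_1 < ... < s_m = 1 of [0, 1], of
   the lengths of the inscribed polygons. *)
Definition path_length g : \bar R :=
  ereal_sup [set (\sum_(i < size s)
                    mdist (g (nth 1 (0 :: s) i)) (g (nth 1 (0 :: s) i.+1)))%:E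
            | s in [set s | itv_partition (0 : R) 1 s]].

(* The path (length) metric of a subset A. *)
Definition path_dist A (x y : X) : \bar R :=
  ereal_inf [set path_length g | g in [set g : R -> X |
    [/\ {within `[0, 1], continuous g}, g @` `[0, 1] `<=` A,
        g 0 = x & g 1 = y]]].

(* c is a parametrization of A by [0, L], isometric when A carries its own path
   metric.  A itself need not be geodesic in X: it may be, for instance, the
   longer of two arcs of a circle. *)
Definition interval_isometry A (L : R) (c : R -> X) : Prop :=
  c @` `[0, L] = A /\
  {in `[0, L] &, forall s t, path_dist A (c s) (c t) = `|s - t|%:E}.

End LengthMetric.

Section Stars.
Context {R : realType} {X : metricType R}.

(* The path metric of the star with n arms; (k, t) is the point at distance t
   from the centre on the arm k. *)
Definition star_dist n (u v : 'I_n * R) : R :=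
  if u.1 == v.1 then `|u.2 - v.2| else u.2 + v.2.

(* a is an isometry from the star with n arms of length r onto a neighbourhood
   of p, mapping the centre to p.  The disjunct q = p only matters for n = 0,
   that is, when p is isolated. *)
Definition star_chart (p : X) (n : nat) (r : R) (a : 'I_n -> R -> X) : Prop :=
  [/\ 0 < r,
      forall k, a k 0 = p,
      forall k l (s t : R), 0 <= s < r -> 0 <= t < r ->
        mdist (a k s) (a l t) = star_dist (k, s) (l, t)
    & nbhs p [set q | q = p \/ exists k (t : R), 0 <= t < r /\ a k t = q]].

Definition valency (p : X) : nat :=
  xget 0%N [set n | exists r (a : 'I_n -> R -> X), star_chart p r a].

Definition branch_point : set X := [set p | valency p <> 2%N].

Definition vertex_set (V : set X) : Prop :=
  [/\ finite_set V, branch_point `<=` V &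
      forall x, ~ V x -> exists (L : R) c, 0 < L /\
        interval_isometry (closure (connected_component (~` V) x)) L c].

(* p has a neighbourhood isometric to an open interval, on which phi is affine. *)
Definition affine_near (phi : X -> R) (p : X) : Prop :=
  exists (r m : R) (c : R -> X),
    [/\ 0 < r, c 0 = p,
        {in `]- r, r[ &, forall s t, mdist (c s) (c t) = `|s - t|},
        nbhs p (c @` `]- r, r[)
      & {in `]- r, r[, forall t, phi (c t) = phi p + m * t}].

Definition PL : set (X -> R) :=
  [set phi | continuous phi /\
     exists S : set X, finite_set S /\ forall p, ~ S p -> affine_near phi p].

(* Minus the sum of the outgoing directional derivatives at p, one for each arm
   of a star chart (the choice of the chart is immaterial). *)
Definition sigma (phi : X -> R) (p : X) : R :=
  xget 0 [set v | exists n r (a : 'I_n -> R -> X), star_chart p r a /\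
    v = - \sum_(k < n) lim ((phi (a k t) - phi p) / t @[t --> 0^'+])].

(* Signed measures with finite support are functions on subsets. *)
Definition Delta (phi : X -> R) : set X -> R :=
  fun A => \sum_(p \in A) sigma phi p.

Definition point_mass (p : X) : set X -> R := fun A => \1_A p.

(* j z x y is j_z(x, y). *)
Definition j (z x y : X) : R :=
  xget (cst 0 : X -> R) [set f | [/\ PL f,
     Delta f = (fun A => point_mass y A - point_mass z A) & f z = 0]] x.

Definition resistance (x y : X) : R := j y x x.

(* The first argument is the auxiliary base point, on which the value does not
   depend. *)
Definition cross_ratio (q x y z w : X) : R :=
  j q x z + j q y w - j q x w - j q y z.

End Stars.

Section MetricGraphs.
Context {R : realType}.

Definition metric_graph (T : metricType R) : Prop :=
  [/\ compact [set: T], connected [set: T], (exists x y : T, x <> y),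
      (forall p : T, exists n r (a : 'I_n -> R -> T), star_chart p r a)
    & forall x y : T, path_dist [set: T] x y = (mdist x y)%:E].

Record edge_segment (T : metricType R) := EdgeSegment {
  edge_set : set T;
  eminus : T;
  eplus : T;
  edge_setP : exists V x, [/\ vertex_set V, ~ V x &
    edge_set = closure (connected_component (~` V) x)];
  edge_endsP : exists (L : R) c, [/\ 0 < L, interval_isometry edge_set L c,
    c 0 = eminus & c L = eplus] }.

End MetricGraphs.

Section Contraction.
Context {R : realType} {T : metricType R} (e : edge_segment T).

Definition edge_equiv (x y : T) : bool :=
  `[< x = y \/ edge_set e x /\ edge_set e y >].

Lemma edge_equiv_refl : reflexive edge_equiv.
Proof. by move=> x; apply/asboolP; left. Qed.

Lemma edge_equiv_sym : symmetric edge_equiv.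
Proof.
by move=> x y; apply/asboolP/asboolP => -[->|[? ?]]; [left|right|left|right].
Qed.

Lemma edge_equiv_trans : transitive edge_equiv.
Proof.
move=> y x z /asboolP[->//|[ex ey]] /asboolP[<-|[_ ez]]; apply/asboolP.
- by right.
- by right.
Qed.

Canonical edge_equivRel :=
  EquivRel edge_equiv edge_equiv_refl edge_equiv_sym edge_equiv_trans.

Definition contraction := {eq_quot edge_equivRel}.
HB.instance Definition _ := Choice.on contraction.

Definition collapse (x : T) : contraction := \pi_({eq_quot edge_equivRel}) x.

Definition edge_dist (x : T) : R := inf [set mdist x p | p in edge_set e].

(* A path of Gamma/e between two points either avoids e or runs through it, in
   which case its part inside e has length 0. *)
Definition pre_contraction_dist (x y : T) : R :=
  Order.min (mdist x y) (edge_dist x + edge_dist y).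

(* Independent of the representatives, see collapse_dist. *)
Definition contraction_dist (a b : contraction) : R :=
  pre_contraction_dist (repr (a : {eq_quot edge_equivRel}))
                       (repr (b : {eq_quot edge_equivRel})).

Lemma edge_set0 : edge_set e !=set0.
Proof.
have [L [c [L0 [<- _] _ _]]] := edge_endsP e.
by exists (c 0), 0 => //=; rewrite in_itv/= lexx ltW.
Qed.

Lemma edge_set_closed : closed (edge_set e).
Proof. by have [V [x [_ _ ->]]] := edge_setP e; exact: closed_closure. Qed.

Lemma edge_dist_has_inf x : has_inf [set mdist x p | p in edge_set e].
Proof.
split; first by have [p ep] := edge_set0; exists (mdist x p), p.
by exists 0 => _ [p _ <-]; exact: mdist_ge0.
Qed.

Lemma edge_dist_ge0 x : 0 <= edge_dist x.
Proof.
apply: lb_le_inf; first by have [] := edge_dist_has_inf x.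
by move=> _ [p _ <-]; exact: mdist_ge0.
Qed.

Lemma edge_dist_le x p : edge_set e p -> edge_dist x <= mdist x p.
Proof. by move=> ep; apply: ge_inf; [have [] := edge_dist_has_inf x|exists p]. Qed.

Lemma edge_dist0 x : edge_set e x -> edge_dist x = 0.
Proof.
by move=> ex; apply/le_anti; rewrite edge_dist_ge0 andbT -(mdistxx x) edge_dist_le.
Qed.

Lemma edge_dist0_in x : edge_dist x = 0 -> edge_set e x.
Proof.
move=> ex0; apply: edge_set_closed => B /nbhs_ballP[d /= d0 dB].
have [_ [p ep <-]] := inf_adherent d0 (edge_dist_has_inf x).
rewrite -/(edge_dist x) ex0 add0r => pd; exists p; split => //.
by apply: dB; rewrite ballEmdist.
Qed.

Lemma edge_dist_lipschitz x y : edge_dist x <= mdist x y + edge_dist y.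
Proof.
rewrite -lerBlDl; apply: lb_le_inf; first by have [] := edge_dist_has_inf y.
move=> _ [p ep <-]; rewrite lerBlDl (le_trans (edge_dist_le x ep))//.
exact: metric_triangle.
Qed.

Lemma contraction_distxx a : contraction_dist a a = 0.
Proof.
rewrite /contraction_dist /pre_contraction_dist mdistxx; apply/min_idPl.
by rewrite addr_ge0 ?edge_dist_ge0.
Qed.

Lemma contraction_dist_sym a b : contraction_dist a b = contraction_dist b a.
Proof.
by rewrite /contraction_dist /pre_contraction_dist metric_sym addrC.
Qed.

Lemma contraction_dist_positivity a b : contraction_dist a b = 0 -> a = b.
Proof.
rewrite /contraction_dist /pre_contraction_dist => ab0.
suff : edge_equiv (repr (a : {eq_quot edge_equivRel}))
                  (repr (b : {eq_quot edge_equivRel})).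
  by move=> /(@eqmodP _ edge_equivRel); rewrite !reprK.
apply/asboolP; move: ab0; rewrite /Order.min; case: ifPn => _.
  by move=> /mdist_positivity ->; left.
move=> /eqP; rewrite paddr_eq0 ?edge_dist_ge0// => /andP[/eqP + /eqP +].
by move=> /edge_dist0_in ? /edge_dist0_in ?; right.
Qed.

Lemma contraction_dist_triangle b a c :
  contraction_dist a c <= contraction_dist a b + contraction_dist b c.
Proof.
rewrite /contraction_dist /pre_contraction_dist.
set x := repr _; set z := repr _; set y := repr _.
have tri := metric_triangle x y z.
have xy := edge_dist_lipschitz x y; have zy := edge_dist_lipschitz z y.
have yy := edge_dist_ge0 y; rewrite (metric_sym z) in zy.
rewrite ge_min /Order.min; case: ifPn => _; case: ifPn => _;
  apply/orP; [left|right|right|right]; lra.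
Qed.

HB.instance Definition _ := @isMetric.Build R contraction contraction_dist
  contraction_distxx contraction_dist_positivity contraction_dist_sym
  contraction_dist_triangle.

Lemma collapse_eq x y :
  collapse x = collapse y <-> x = y \/ edge_set e x /\ edge_set e y.
Proof.
by split=> [/eqmodP/asboolP//|xy]; apply/eqmodP/asboolP.
Qed.

Lemma collapse_dist x y :
  mdist (collapse x) (collapse y) = pre_contraction_dist x y.
Proof.
have H u v v' : v = v' \/ edge_set e v /\ edge_set e v' ->
    pre_contraction_dist u v = pre_contraction_dist u v'.
  case=> [->//|[ev ev']]; rewrite /pre_contraction_dist.
  by rewrite (edge_dist0 ev) (edge_dist0 ev') !addr0 !min_r// edge_dist_le.
have S u v : pre_contraction_dist u v = pre_contraction_dist v u.
  by rewrite /pre_contraction_dist metric_sym addrC.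
have K u :
    repr (collapse u) = u \/ edge_set e (repr (collapse u)) /\ edge_set e u.
  by apply/collapse_eq; rewrite /collapse reprK.
rewrite /mdist/= /contraction_dist (H _ _ _ (K y)) S (H _ _ _ (K x)).
exact: S.
Qed.

End Contraction.

Section Interior.
Context {R : realType} {T : metricType R}.

Definition edge_interior (e : edge_segment T) : set T :=
  [set p | edge_set e p /\ p <> eminus e /\ p <> eplus e].

(* The divisor [x] - [z] has no support in the interior of e.  Through the
   quotient map, the contraction formula for j_z(x, y) needs this for [x] - [z]
   or for [y] - [z]: its two sides differ by the Green function of e (zero at
   its ends) paired with these divisors.  For instance, if Gamma = e = [0, 1],
   z = 0 and x = y = 1/2, the left-hand side is 0 whereas the right-hand side
   is 1/2 - (1/2)^2 / 1 = 1/4. *)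
Definition div_off_interior (e : edge_segment T) (x z : T) : Prop :=
  x = z \/ ~ edge_interior e x /\ ~ edge_interior e z.

End Interior.

(* Main.v *)
(* Everything is local: the Laplacian of f at p is read off a star around p on
   whose arms f is affine, and uniqueness of potentials is the maximum principle.

   Existence and reciprocity (Delta f = [y'] - [z'] and Delta g = [y] - [z] imply
   g y' - g z' = f y - f z) come together by duality, without a model of the
   graph by vertices and edges.  If no such g exists, a linear functional kills
   the Laplacians of all tent functions on stars where f is affine, for which
   Green's formula against f is trivial, but not [y] - [z]; as a function of the
   point, it is then affine on small stars and harmonic, hence constant.

   Let h be the potential of [e-] - [e+].  By uniqueness xi(x, z, e-, e+) is
   h x - h z and r(e-, e+) is h e- - h e+.  If y and z are not interior to e, then
   f x = j_z(x, y) - (h x - h z) (h y - h z) / (h e- - h e+) is harmonic inside e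
   and, by reciprocity, takes the same value at e- and e+, hence is constant on e.
   So it descends to Gamma/e, where the Laplacian at the point e is the sum of
   those of f at e- and e+: this is [y] - [z].  The other case follows by the
   symmetry of j_z, again reciprocity. *)
Require Import Defs.
From mathcomp Require Import all_boot all_order all_algebra generic_quotient.
From mathcomp Require Import lra.
From mathcomp Require Import all_classical all_reals all_analysis.

Set Implicit Arguments.
Unset Strict Implicit.
Unset Printing Implicit Defensive.

Import Order.TTheory GRing.Theory Num.Theory.
Import numFieldNormedType.Exports.

Local Open Scope classical_set_scope.
Local Open Scope quotient_scope.
Local Open Scope ring_scope.

(** * Stars *)

Section MetricSpaces.
Context {R : realType} {X : metricType R}.
Implicit Types (p q x : X) (A : set X).

Lemma nbhs_mdistP p (A : set X) :
  nbhs p A <-> exists2 r : R, 0 < r & forall q, mdist p q < r -> A q.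
Proof.
split=> [/nbhs_ballP[r /= r0 rA]|[r r0 rA]].
  by exists r => // q pq; apply: rA; rewrite ballEmdist.
apply/nbhs_ballP; exists r => // q; rewrite ballEmdist; exact: rA.
Qed.

Lemma finite_set_separated (S : set X) p : finite_set S ->
  exists2 r : R, 0 < r & forall q, S q -> mdist p q < r -> q = p.
Proof.
move=> finS; have : nbhs p (~` (S `\ p)).
  apply: open_nbhs_nbhs; split; last by move=> [_]; exact.
  apply: closed_openC; apply: (accessible_finite_set_closed.1 _).
    by apply: hausdorff_accessible; exact: metric_hausdorff.
  exact: finite_setD.
move=> /nbhs_mdistP[r r0 rA]; exists r => // q Sq /rA qp.
by apply: contrapT => qNp; apply: qp.
Qed.

Lemma mdist_lipschitz_continuous {Y : metricType R} (g : X -> Y) (M : R) (p : X) :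
  (\forall q \near p, mdist (g p) (g q) <= M * mdist p q) ->
  {for p, continuous g}.
Proof.
move=> gM; apply/metricType_numDomainType.cvgrPdist_lt => /= eps eps0.
move/nbhs_mdistP: gM => [r r0 gM]; apply/nbhs_mdistP.
pose M' : R := `|M| + 1; have M'0 : 0 < M' by rewrite ltr_wpDl.
exists (Num.min r (eps / M')); first by rewrite lt_min r0 divr_gt0.
move=> q; rewrite lt_min => /andP[qr qe].
apply: (le_lt_trans (gM _ qr)).
apply: (@le_lt_trans _ _ (M' * mdist p q)).
  by apply: ler_wpM2r; [exact: mdist_ge0|]; rewrite /M'; have := ler_norm M; lra.
by rewrite mulrC -ltr_pdivlMr.
Qed.

End MetricSpaces.

Section StarBalls.
Context {R : realType} {X : metricType R}.
Implicit Types (p q x : X) (f g : X -> R).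

(* The open ball of radius r around p is a star; unlike in star_chart, the arms
   are indexed by any finite type and fill the whole ball. *)
Definition star_ball (J : finType) (p : X) (r : R) (a : J -> R -> X) : Prop :=
  [/\ 0 < r,
      forall k, a k 0 = p,
      forall k l (s t : R), 0 <= s < r -> 0 <= t < r ->
        mdist (a k s) (a l t) = if k == l then `|s - t| else s + t
    & forall q, mdist p q < r -> q = p \/ exists k, q = a k (mdist p q)].

Section Basics.
Context (J : finType) (p : X) (r : R) (a : J -> R -> X).
Hypothesis pra : star_ball p r a.

Lemma star_ball_gt0 : 0 < r. Proof. by case: pra. Qed.

Lemma star_ball0 k : a k 0 = p. Proof. by case: pra. Qed.

Lemma star_ball_dist k l s t : 0 <= s < r -> 0 <= t < r ->
  mdist (a k s) (a l t) = if k == l then `|s - t| else s + t.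
Proof. by case: pra => _ _ H _; exact: H. Qed.

Lemma star_ball_dist0 k t : 0 <= t < r -> mdist p (a k t) = t.
Proof.
move=> /andP[t0 tr]; rewrite -(star_ball0 k) star_ball_dist ?eqxx ?sub0r ?normrN.
- by rewrite ger0_norm.
- by rewrite lexx/= (le_lt_trans t0).
- by rewrite t0.
Qed.

Lemma star_ball_cover q : mdist p q < r -> q = p \/ exists k, q = a k (mdist p q).
Proof. by case: pra => _ _ _; exact. Qed.

(** The parameter of a point is its distance to [p], and points on different arms are [s + t] apart.
    At [s = 0] all arms meet, hence the strict bound. *)
Lemma star_ball_inj k l s t : 0 < s < r -> 0 <= t < r -> a k s = a l t ->
  k = l /\ s = t.
Proof.
move=> /andP[s0 sr] tr E; have s0r : 0 <= s < r by rewrite ltW.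
have st : s = t by rewrite -(star_ball_dist0 k s0r) E star_ball_dist0.
split=> //; apply/eqP/negPn/negP => kl.
have := star_ball_dist k l s0r tr; rewrite (negPf kl) E mdistxx.
by move: s0 tr => + /andP[]; lra.
Qed.

Lemma star_ball_le r' : 0 < r' <= r -> star_ball p r' a.
Proof.
move=> /andP[r'0 r'r]; split => //.
- exact: star_ball0.
- move=> k l s t /andP[s0 sr] /andP[t0 tr].
  by apply: star_ball_dist; rewrite ?s0 ?t0/= (lt_le_trans _ r'r).
- by move=> q qr; apply: star_ball_cover; exact: lt_le_trans r'r.
Qed.

Lemma star_ball_nbhs (P : set X) : P p ->
  (forall k t, 0 <= t < r -> P (a k t)) -> nbhs p P.
Proof.
move=> Pp Pa; apply/nbhs_mdistP; exists r; first exact: star_ball_gt0.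
move=> q qr; have [->//|[k ->]] := star_ball_cover qr.
by apply: Pa; rewrite mdist_ge0.
Qed.

(** Off the centre a star is an interval: the arm [true] points away from [p], the arm [false]
    towards it. The radius stops them before [p] and before the end of the arm. *)
Lemma star_ball_arc k t : 0 < t < r ->
  star_ball (a k t) (Num.min t (r - t))
    (fun (b : bool) s => a k (if b then t + s else t - s)).
Proof.
move=> /andP[t0 tr]; set r' := Num.min _ _.
have r'0 : 0 < r' by rewrite lt_min t0 subr_gt0.
have [r't r'rt] : r' <= t /\ r' <= r - t.
  by split; rewrite /r' ge_min lexx// orbT.
have tI : 0 <= t < r by rewrite ltW.
split => //.
- by case; rewrite ?addr0 ?subr0.
- move=> b c s u /andP[s0 sr] /andP[u0 ur].
  rewrite star_ball_dist ?eqxx.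
  + case: b; case: c => /=.
    * by congr `|_|; lra.
    * by rewrite ger0_norm; lra.
    * by rewrite ler0_norm; lra.
    * by rewrite -normrN; congr `|_|; lra.
  + by case: b; apply/andP; split; lra.
  + by case: c; apply/andP; split; lra.
- move=> q qr; have pq : mdist p q < r.
    have := metric_triangle p (a k t) q; rewrite star_ball_dist0//; lra.
  have [qp|[l ql]] := star_ball_cover pq.
    have := star_ball_dist0 k tI; rewrite metric_sym -qp => E.
    by exfalso; move: qr; rewrite E; lra.
  right; have d0 := mdist_ge0 p q; have qI : 0 <= mdist p q < r by rewrite d0.
  move: qr; rewrite ql star_ball_dist//.
  case: eqVneq => [kl|_] qr; last by exfalso; lra.
  exists (t <= mdist p q); case: lerP => tq; rewrite kl; congr (a l _); lra.
Qed.

End Basics.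

(** A chart covers some ball around [p]. Since the parameter is the distance to [p], cutting the
    arms at the radius of that ball makes them fill it. *)
Lemma star_ball_of_chart n p r (a : 'I_n -> R -> X) : star_chart p r a ->
  exists2 r', 0 < r' <= r & star_ball p r' a.
Proof.
case=> r0 a0 ad /nbhs_mdistP[r1 r10 H].
exists (Num.min r r1); first by rewrite lt_min r0 r10 ge_min lexx.
split => //; first by rewrite lt_min r0.
- move=> k l s t; rewrite !lt_min => /and3P[s0 sr _] /and3P[t0 tr _].
  by rewrite ad ?s0 ?t0.
- move=> q; rewrite lt_min => /andP[qr qr1].
  have [->|[k [t [/andP[t0 tr] <-]]]] := H q qr1; first by left.
  right; exists k; congr (a k _); rewrite -(a0 k) ad ?t0 ?lexx//.
  by rewrite /star_dist/= eqxx sub0r normrN ger0_norm.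
Qed.

Lemma star_chart_of_ball (J : finType) p r (a : J -> R -> X) :
  star_ball p r a -> star_chart p r (fun i : 'I_#|J| => a (enum_val i)).
Proof.
move=> pra; split; first exact: star_ball_gt0 pra.
- by move=> k; exact: star_ball0 pra _.
- move=> k l s t sr tr; rewrite (star_ball_dist pra)// /star_dist/=.
  by rewrite (inj_eq enum_val_inj).
- apply: (star_ball_nbhs pra); first by left.
  move=> k t tr; right; exists (enum_rank k), t; split => //.
  by rewrite enum_rankK.
Qed.

(** The point of arm [k] at half the common radius selects an arm of the other star. The rest of arm
    [k] must follow it: across two arms distances would add up instead of subtracting. Exchanging
    the two stars gives the inverse. *)
Lemma star_ball_change (J K : finType) p r r' (a : J -> R -> X) (b : K -> R -> X) :
  star_ball p r a -> star_ball p r' b ->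
  exists2 phi : J -> K, bijective phi &
    forall k t, 0 <= t < Num.min r r' -> a k t = b (phi k) t.
Proof.
have H (J1 J2 : finType) r1 r2 (a1 : J1 -> R -> X) (a2 : J2 -> R -> X) :
    star_ball p r1 a1 -> star_ball p r2 a2 ->
    forall k, exists l, forall t, 0 <= t < Num.min r1 r2 -> a1 k t = a2 l t.
  move=> p1 p2 k; set rho := Num.min _ _.
  have rho0 : 0 < rho by rewrite lt_min (star_ball_gt0 p1) (star_ball_gt0 p2).
  have [rho1 rho2] : rho <= r1 /\ rho <= r2.
    by split; rewrite ge_min lexx ?orbT.
  have E t : 0 < t < rho -> exists l, a1 k t = a2 l t.
    move=> /andP[t0 tr].
    have d : mdist p (a1 k t) = t.
      by apply: (star_ball_dist0 p1); apply/andP; split; lra.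
    have [|E|[l ->]] := star_ball_cover p2 (q := a1 k t); rewrite ?d; [lra| |].
      by move: d; rewrite E mdistxx => d; exfalso; lra.
    by exists l.
  have [|l El] := E (rho / 2); first by apply/andP; split; lra.
  exists l => t /andP[]; rewrite le_eqVlt => /predU1P[<- _|t0 tr].
    by rewrite (star_ball0 p1) (star_ball0 p2).
  have [|l' El'] := E t; first by rewrite t0.
  have I1 : 0 <= t < r1 by apply/andP; split; lra.
  have I2 : 0 <= rho / 2 < r1 by apply/andP; split; lra.
  have := star_ball_dist p1 k k I1 I2.
  have J1' : 0 <= t < r2 by apply/andP; split; lra.
  have J2' : 0 <= rho / 2 < r2 by apply/andP; split; lra.
  rewrite El El' (star_ball_dist p2 _ _ J1' J2') eqxx.
  case: eqVneq => [->//|_] h; exfalso.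
  by case: (lerP t (rho / 2)) h => _; lra.
move=> pa pb; have [phi Hphi] := choice (H _ _ _ _ _ _ pa pb).
have [psi Hpsi] := choice (H _ _ _ _ _ _ pb pa).
exists phi => //; set rho := Num.min r r' in Hphi *.
rewrite minC -/rho in Hpsi.
have rho0 : 0 < rho by rewrite lt_min (star_ball_gt0 pa) (star_ball_gt0 pb).
have [rho1 rho2] : rho <= r /\ rho <= r' by split; rewrite ge_min lexx ?orbT.
have I : 0 <= rho / 2 < rho by apply/andP; split; lra.
exists psi => k.
- have := Hphi k _ I; rewrite (Hpsi (phi k) _ I).
  by case/(star_ball_inj pa) => //; apply/andP; split; lra.
- have := Hpsi k _ I; rewrite (Hphi (psi k) _ I).
  by case/(star_ball_inj pb) => //; apply/andP; split; lra.
Qed.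

(* v = sigma f p, computed in a star on whose arms f is affine. *)
Definition has_sigma f p (v : R) : Prop :=
  exists (J : finType) r (a : J -> R -> X) (m : J -> R),
    [/\ star_ball p r a,
        forall k t, 0 <= t < r -> f (a k t) = f p + m k * t
      & v = - \sum_k m k].

(** Independence of the chart: near [p] the arms of two stars correspond bijectively, which
    transports the slopes and preserves their sum. *)
Lemma has_sigma_chart f p v (K : finType) r' (b : K -> R -> X) :
  has_sigma f p v -> star_ball p r' b ->
  exists r (m : K -> R), [/\ 0 < r <= r', star_ball p r b,
    forall k t, 0 <= t < r -> f (b k t) = f p + m k * t & v = - \sum_k m k].
Proof.
move=> [J [r [a [m [pa fa ->]]]]] pb.
have [phi bphi Hphi] := star_ball_change pb pa.
have I : 0 < Num.min r' r <= r'.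
  by rewrite lt_min (star_ball_gt0 pa) (star_ball_gt0 pb) ge_min lexx.
exists (Num.min r' r), (m \o phi); split => //.
- exact: star_ball_le pb _ I.
- move=> k t tr; rewrite Hphi// fa//.
  by move: tr; rewrite lt_min => /and3P[-> _ ->].
- by rewrite (reindex phi) //; exact: onW_bij.
Qed.

End StarBalls.

(** * The Laplacian and the maximum principle *)

Section Sigma.
Context {R : realType} {X : metricType R}.
Implicit Types (p q x : X) (f g : X -> R).

(** Close to 0 the difference quotient along an arm is constantly the slope, and every chart yields
    the same sum, so the choice made by [sigma] is forced. *)
Lemma has_sigma_sigma f p v : has_sigma f p v -> sigma f p = v.
Proof.
move=> fpv; have slope n r (b : 'I_n -> R -> X) : star_chart p r b ->
    v = - \sum_(k < n) lim ((f (b k t) - f p) / t @[t --> 0^'+]).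
  move=> /star_ball_of_chart[r' _ pb].
  have [r1 [m [/andP[r10 _] _ fb ->]]] := has_sigma_chart fpv pb.
  congr (- _); apply: eq_bigr => k _; apply/esym.
  apply: lim_near_cst; first exact: Rhausdorff.
  near=> t; have t0 : 0 < t by near: t; exact: nbhs_right_gt.
  have tr1 : t < r1 by near: t; exact: nbhs_right_lt.
  by rewrite fb ?ltW//= (addrC (f p)) addrK mulfK// gt_eqF.
apply: xget_unique; last by move=> w [n [r [b [/slope <- ->]]]].
case: (fpv) => J [r [a [m [/star_chart_of_ball pa _ _]]]].
by exists #|J|, r, (fun i => a (enum_val i)); split => //; exact: slope pa.
Unshelve. all: end_near. Qed.

Lemma has_sigma_unique f p v w : has_sigma f p v -> has_sigma f p w -> v = w.
Proof. by move=> /has_sigma_sigma <- /has_sigma_sigma. Qed.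

Lemma has_sigma_lin (c : R) f g p v w : has_sigma f p v -> has_sigma g p w ->
  has_sigma (fun x => c * f x + g x) p (c * v + w).
Proof.
move=> [J [r [a [m [pa fa ->]]]]] gpw.
have [r' [m' [/andP[r'0 r'r] pa' ga ->]]] := has_sigma_chart gpw pa.
exists J, r', a, (fun k => c * m k + m' k); split=> //.
- move=> k t /andP[t0 tr]; rewrite fa ?ga ?t0//; last exact: lt_le_trans r'r.
  lra.
- by rewrite big_split/= -mulr_sumr; lra.
Qed.

Lemma has_sigma_near f g p v : (\forall x \near p, f x = g x) ->
  has_sigma f p v -> has_sigma g p v.
Proof.
move=> fg [J [r [a [m [pa fa ->]]]]].
have fgp : f p = g p := nbhs_singleton fg.
move/nbhs_mdistP: fg => [r1 r10 fg].
have I : 0 < Num.min r r1 <= r.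
  by rewrite lt_min (star_ball_gt0 pa) r10 ge_min lexx.
exists J, (Num.min r r1), a, m; split=> //; first exact: star_ball_le pa _ I.
move=> k t; rewrite lt_min => /and3P[t0 tr tr1].
by rewrite -fg ?fa ?fgp ?t0// (star_ball_dist0 pa)// t0.
Qed.

Lemma has_sigma_continuous f p v : has_sigma f p v -> {for p, continuous f}.
Proof.
move=> [J [r [a [m [pa fa _]]]]].
apply: (@mdist_lipschitz_continuous _ _ R^o _ (\sum_k `|m k|)).
apply/nbhs_mdistP; exists r; first exact: star_ball_gt0 pa.
move=> q qr; have [->|[k Ek]] := star_ball_cover pa qr.
  by rewrite !mdistxx mulr0.
rewrite {1}Ek fa ?qr ?mdist_ge0//.
have -> (x y : R^o) : mdist x y = `|y - x| by [].
rewrite (addrC (f p)) addrK normrM (ger0_norm (mdist_ge0 _ _)).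
by rewrite ler_wpM2r ?mdist_ge0// (bigD1 k)//= lerDl sumr_ge0.
Qed.

(* Each slope is nonpositive at a maximum, and their sum is - v >= 0. *)
Lemma has_sigma_local_max f p v : has_sigma f p v -> v <= 0 ->
  (\forall x \near p, f x <= f p) -> \forall x \near p, f x = f p.
Proof.
move=> [J [r [a [m [pa fa ->]]]]] m0 /nbhs_mdistP[r1 r10 fmax].
have r0 := star_ball_gt0 pa.
have mk k : 0 <= - m k.
  pose t := Num.min r r1 / 2.
  have t0 : 0 < Num.min r r1 by rewrite lt_min r0.
  have tr : Num.min r r1 <= r by rewrite ge_min lexx.
  have tr1 : Num.min r r1 <= r1 by rewrite ge_min lexx orbT.
  have tI : 0 <= t < r by rewrite /t; apply/andP; split; lra.
  have := fmax (a k t); rewrite (star_ball_dist0 pa)// fa//.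
  have -> : t < r1 by rewrite /t; lra.
  rewrite gerDl oppr_ge0 => /(_ isT); rewrite pmulr_lle0//.
  by rewrite /t; lra.
have {}m0 : \sum_k - m k = 0.
  by apply/le_anti; rewrite sumr_ge0// andbT sumrN.
have {}mk k : m k = 0.
  apply/eqP; rewrite -oppr_eq0; apply/eqP.
  exact: (psumr_eq0P (fun i _ => mk i) m0).
apply: (star_ball_nbhs pa) => // k t tr.
by rewrite fa// mk mul0r addr0.
Qed.

(** If the conclusion fails, the points of [K] where the maximum is attained all lie in [O]. They
    form a closed set, open by [has_sigma_local_max], hence all of [X] by connectedness; but [O]
    misses a point of [K]. *)
Lemma maximum_principle f (K O : set X) :
  compact [set: X] -> connected [set: X] -> continuous f ->
  closed K -> open O -> O `<=` K -> K `\` O !=set0 ->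
  (forall p, O p -> exists2 v, has_sigma f p v & v <= 0) ->
  forall x, K x -> exists2 b, (K `\` O) b & f x <= f b.
Proof.
move=> cptX conX fc cK oO OK [b0 [Kb0 Ob0]] fO x Kx.
have cptK : compact K by apply: subclosed_compact cK cptX _.
have Kn0 : K !=set0 by exists x.
have [p] := compact_EVT_max Kn0 cptK (continuous_subspaceT fc).
rewrite inE => Kp pmax; apply: contrapT => nob.
have SO q : K q -> f q = f p -> O q.
  move=> Kq qp; apply: contrapT => Oq; apply: nob; exists q => //.
  by rewrite qp pmax// inE.
have E : K `&` [set q | f q = f p] = setT.
  apply: conX; first by exists p.
  - exists (K `&` [set q | f q = f p]); last by rewrite setTI.
    rewrite openE => q [Kq fq]; have Oq := SO q Kq fq.
    have [v fv v0] := fO q Oq.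
    have nO : nbhs q O by exact: open_nbhs_nbhs.
    have := has_sigma_local_max fv v0 _; rewrite fq => lm.
    have fqp : \forall z \near q, f z <= f p.
      by apply: filterS nO => z Oz; apply: pmax; rewrite inE; exact: OK.
    apply: filterS2 nO (lm fqp) => z Oz fz; split => //; exact: OK.
  - exists (K `&` [set q | f q = f p]); last by rewrite setTI.
    apply: closedI => //.
    by apply: (@preimage_closed _ _ f [set f p]).
have [_ fb0] : (K `&` [set q | f q = f p]) b0 by rewrite E.
by apply: Ob0; exact: SO.
Qed.

Lemma has_sigma_le f x0 : compact [set: X] -> connected [set: X] ->
  (forall p, exists v, has_sigma f p v /\ (p <> x0 -> v <= 0)) ->
  forall x, f x <= f x0.
Proof.
move=> cptX conX fX x.
have fc : continuous f by move=> p; have [v [/has_sigma_continuous]] := fX p.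
have oO : open (~` [set x0]).
  apply: closed_openC; apply: accessible_closed_set1.
  by apply: hausdorff_accessible; exact: metric_hausdorff.
have ne : setT `\` ~` [set x0] !=set0 by exists x0; split => //; exact.
have fO p : (~` [set x0]) p -> exists2 v, has_sigma f p v & v <= 0.
  by move=> p0; have [v [fv v0]] := fX p; exists v => //; exact: v0.
have [b [_ /contrapT ->]//] :=
  maximum_principle cptX conX fc closedT oO (@subsetT _ _) ne fO (x := x) Logic.I.
Qed.

Lemma has_sigma0_cst f : compact [set: X] -> connected [set: X] ->
  (forall p, has_sigma f p 0) -> forall x y, f x = f y.
Proof.
move=> cptX conX f0 x y; apply/le_anti; apply/andP.
by split; apply: has_sigma_le => // p; exists 0.
Qed.

End Sigma.

(** * Piecewise linear functions *)

(** The local slope [psi] is the derivative of [phi] and is itself locally constant. The mean value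
    theorem, applied to [psi] and then to [phi], makes [psi] constant and [phi] affine. *)
Lemma locally_affine_affine {R : realType} (phi : R -> R) (r : R) :
  (forall t, 0 < t < r -> exists m d, 0 < d /\
     forall s, `|s - t| < d -> phi s = phi t + m * (s - t)) ->
  exists m, forall s t, 0 < s < r -> 0 < t < r -> phi t = phi s + m * (t - s).
Proof.
move=> aff; have [psi Hpsi] : {psi : R -> R & forall t, 0 < t < r ->
    exists2 d, 0 < d & forall s, `|s - t| < d -> phi s = phi t + psi t * (s - t)}.
  apply: (@choice _ _ (fun t m => 0 < t < r -> exists2 d, 0 < d &
    forall s, `|s - t| < d -> phi s = phi t + m * (s - t))) => t.
  case: (pselect (0 < t < r)) => [/aff[m [d [d0 mP]]]|tN]; last by exists 0.
  by exists m; exists d.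
have ball (t d : R) (P : set R) : 0 < d ->
    (forall s, `|s - t| < d -> P s) -> \forall s \near (t : R^o), P s.
  move=> d0 H; apply/nbhs_ballP; exists d => //= s.
  by rewrite /ball/= distrC; exact: H.
have dphi t : 0 < t < r -> is_derive (t : R^o) (1 : R^o) (phi : R^o -> R^o) (psi t).
  move=> /Hpsi[d d0 tP].
  have E : \forall s \near (t : R^o), phi t + psi t * (s - t) = phi s.
    by apply: (ball _ d) => // s /tP ->.
  apply: (near_eq_is_derive (V := R^o) (W := R^o) E).
  by apply: is_derive_eq; rewrite /= /GRing.scale/=; lra.
have dpsi t : 0 < t < r -> is_derive (t : R^o) (1 : R^o) (psi : R^o -> R^o) 0.
  move=> tI; have [d d0 tP] := Hpsi _ tI; move/andP: tI => [t0 tr].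
  have E : \forall s \near (t : R^o), psi t = psi s.
    apply: (ball _ (Num.min d (Num.min t (r - t)))).
      by rewrite !lt_min d0 t0 subr_gt0.
    move=> s; rewrite !lt_min => /and3P[sd st sr].
    have [|d' d'0 sP] := Hpsi s.
      by move: st sr; rewrite !ltr_norml => /andP[? ?] /andP[? ?]; apply/andP; split; lra.
    (* [s + h] is close to both [s] and [t], so the increment of [phi] from [s] to [s + h] is
       [psi s * h] as well as [psi t * h]. *)
    pose h := Num.min d' (d - `|s - t|) / 2.
    have h0 : 0 < Num.min d' (d - `|s - t|) by rewrite lt_min d'0 subr_gt0.
    have hd' : Num.min d' (d - `|s - t|) <= d' by rewrite ge_min lexx.
    have hd : Num.min d' (d - `|s - t|) <= d - `|s - t|.
      by rewrite ge_min lexx orbT.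
    have h0' : 0 < h by rewrite divr_gt0.
    have shd : `|s + h - t| < d.
      rewrite addrAC (le_lt_trans (ler_normD _ _))// (gtr0_norm h0') /h; lra.
    have hs : `|s + h - s| < d' by rewrite addrAC subrr add0r gtr0_norm// /h; lra.
    have := sP _ hs; rewrite (tP _ shd) (tP _ sd) => e; apply: (mulIf (lt0r_neq0 h0')).
    lra.
  exact: (near_eq_is_derive (V := R^o) (W := R^o) E (is_derive_cst _ _ _)).
have mvt (f df : R -> R) s t : 0 < s < r -> 0 < t < r -> s < t ->
    (forall u, 0 < u < r -> is_derive (u : R^o) (1 : R^o) (f : R^o -> R^o) (df u)) ->
    exists2 c, 0 < c < r & f t - f s = df c * (t - s).
  move=> /andP[s0 sr] /andP[t0 tr] st fdf.
  have I u : u \in `[s, t] -> 0 < u < r.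
    by rewrite in_itv/= => /andP[? ?]; apply/andP; split; lra.
  have [||c cI E] := MVT st (f := f) (df := df).
  - by move=> u /subset_itv_oo_cc/I; exact: fdf.
  - apply: derivable_within_continuous => u /I/fdf duf.
    by case: duf.
  - by exists c => //; apply: I; exact: subset_itv_oo_cc.
have psic s t : 0 < s < r -> 0 < t < r -> psi s = psi t.
  wlog st : s t / s < t.
    move=> W sI tI; have [st|ts|->//] := ltgtP s t; first exact: W.
    by apply/esym; exact: W.
  move=> sI tI; have [c _] := mvt psi (fun=> 0) s t sI tI st dpsi.
  by rewrite mul0r => /subr0_eq.
exists (psi (r / 2)) => s t.
wlog st : s t / s < t.
  move=> W sI tI; have [st|ts|->//] := ltgtP s t; first exact: W.
    have := W _ _ ts tI sI; lra.
  by rewrite subrr mulr0 addr0.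
move=> sI tI; have [c cI] := mvt phi psi s t sI tI st dphi.
rewrite (psic c (r / 2)) //; first lra.
by case/andP: sI => ? ?; apply/andP; split; lra.
Qed.

(** On the line, the distances to the two points [0] and [h] determine a point. This is why two
    isometric parametrizations of an interval agree up to a reflection. *)
Lemma eq_of_eq_norm {R : realDomainType} (s u h : R) : h != 0 ->
  `|s| = `|u| -> `|s - h| = `|u - h| -> s = u.
Proof.
move=> h0 /eqP; rewrite eqr_norm2 => /orP[/eqP//|/eqP ->] /eqP.
by rewrite eqr_norm2 => /orP[] /eqP e; move: h0; move=> /eqP h0; [lra|case: h0; lra].
Qed.

Section PiecewiseLinear.
Context {R : realType} {X : metricType R}.
Implicit Types (p q x : X) (f g : X -> R).

(** Around [a k t0] both the arm and the chart [c] are isometric parametrizations, so they differ by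
    a sign, read off at [t0 + d / 2]; the slope along the arm is [m] or [- m] accordingly. *)
Lemma affine_near_arm f (J : finType) p r (a : J -> R -> X) k t0 :
  star_ball p r a -> 0 < t0 < r -> affine_near f (a k t0) ->
  exists m d, 0 < d /\
    forall t, `|t - t0| < d -> f (a k t) = f (a k t0) + m * (t - t0).
Proof.
move=> pa /andP[t00 t0r] [r' [m [c [r'0 c0 cd /nbhs_mdistP[d1 d10 cN] fc]]]].
pose d := Num.min d1 (Num.min t0 (r - t0)).
have d0 : 0 < d by rewrite !lt_min d10 t00 subr_gt0.
have [dd1 dt0 dr] : [/\ d <= d1, d <= t0 & d <= r - t0].
  by rewrite /d !ge_min !lexx ?orbT.
have ad t u : `|t - t0| < d -> `|u - t0| < d -> mdist (a k t) (a k u) = `|t - u|.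
  rewrite !ltr_norml => /andP[? ?] /andP[? ?].
  by rewrite (star_ball_dist pa) ?eqxx//; apply/andP; split; lra.
have t0d : `|t0 - t0| < d by rewrite subrr normr0.
have zI : 0 \in `]- r', r'[ by rewrite in_itv/= oppr_lt0 r'0.
have as_ t : `|t - t0| < d ->
    exists s, [/\ s \in `]- r', r'[, c s = a k t & `|s| = `|t - t0|].
  move=> td; have [|s sI cs] := cN (a k t).
    by rewrite ad// distrC (lt_le_trans td).
  by exists s; split => //; rewrite -(ad _ _ td t0d) -cs -c0 cd// subr0.
have t1d : `|t0 + d / 2 - t0| < d by rewrite addrAC subrr add0r gtr0_norm; lra.
have [s1 [s1I cs1]] := as_ _ t1d.
rewrite addrAC subrr add0r => /eqP; rewrite eqr_norm2 => /orP[/eqP s1E|/eqP s1E].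
- exists m, d; split => // t td; have [s [sI cs sE]] := as_ _ td.
  have s1d : `|s - d / 2| = `|t - t0 - d / 2|.
    by rewrite -{1}s1E -cd// cs cs1 ad// opprD addrA.
  rewrite -cs fc//; congr (_ + m * _).
  by apply: (eq_of_eq_norm _ sE s1d); rewrite gt_eqF// divr_gt0.
- exists (- m), d; split => // t td; have [s [sI cs sE]] := as_ _ td.
  have s1d : `|s - - (d / 2)| = `|t - t0 - d / 2|.
    by rewrite -{1}s1E -cd// cs cs1 ad// opprD addrA.
  rewrite -cs fc// mulNr -mulrN; congr (_ + m * _).
  apply: oppr_inj; rewrite opprK.
  apply: (eq_of_eq_norm (h := d / 2)); rewrite ?gt_eqF// ?divr_gt0//.
    by rewrite normrN.
  by rewrite -s1d -normrN opprD opprK.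
Qed.

Definition star_space : Prop :=
  forall p, exists (J : finType) r (a : J -> R -> X), star_ball p r a.

Lemma star_space_cst (c : R) p : star_space -> has_sigma (fun=> c) p 0.
Proof.
move=> /(_ p)[J [r [a pa]]]; exists J, r, a, (fun=> 0); split=> //.
- by move=> k t _; rewrite mul0r addr0.
- by rewrite big1 ?oppr0.
Qed.

(** In a star containing no break point except possibly [p], [f] is locally affine on each open arm,
    hence affine there. Continuity at [p] identifies the value of the affine formula at 0. *)
Lemma PL_has_sigma f p : star_space -> PL f -> exists v, has_sigma f p v.
Proof.
move=> starX [fc [S [finS fS]]]; have [J [r [a pa]]] := starX p.
have [r1 r10 Sr1] := finite_set_separated p finS.
have rr : 0 < Num.min r r1 <= r.
  by rewrite lt_min (star_ball_gt0 pa) r10 ge_min lexx.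
have {}pa := star_ball_le pa rr.
have {}Sr1 q : S q -> mdist p q < Num.min r r1 -> q = p.
  by move=> Sq; rewrite lt_min => /andP[_ qr]; exact: Sr1.
move: (Num.min r r1) pa Sr1 => {rr r1 r10}r' pa Sr'; have r'0 := star_ball_gt0 pa.
suff H k : exists m, forall t, 0 <= t < r' -> f (a k t) = f p + m * t.
  have [m mP] := choice H.
  by exists (- \sum_k m k), J, r', a, m; split.
have [m mP] : exists m, forall s t, 0 < s < r' -> 0 < t < r' ->
    f (a k t) = f (a k s) + m * (t - s).
  apply: (@locally_affine_affine _ (fun t => f (a k t))) => t tI.
  apply: (affine_near_arm pa tI); apply: fS => Sa.
  have tI' : 0 <= t < r' by case/andP: tI => t0 ->; rewrite ltW.
  have ap : a k t = p by apply: Sr' => //; rewrite (star_ball_dist0 pa)//; case/andP: tI.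
  have := star_ball_dist0 pa k tI'; rewrite ap mdistxx.
  by case/andP: tI => t0 _ e; move: t0; rewrite -e ltxx.
exists m => t /andP[]; rewrite le_eqVlt => /predU1P[<- _|t0 tr].
  by rewrite (star_ball0 pa) mulr0 addr0.
have tI : 0 < t < r' by rewrite t0.
have lim1 : f (a k s) @[s --> 0^'+] --> f p.
  apply: (@cvg_comp _ _ _ (a k) f _ (nbhs p)); last exact: fc.
  apply/metricType_numDomainType.cvgrPdist_lt => /= eps eps0.
  near=> s; rewrite (star_ball_dist0 pa).
    near: s; exact: nbhs_right_lt.
  by apply/andP; split; [apply: ltW|]; near: s;
    [exact: nbhs_right_gt|exact: nbhs_right_lt].
have lim2 : f (a k s) @[s --> 0^'+] --> f (a k t) + m * (0 - t).
  have : (fun s => f (a k t) + m * (s - t)) s @[s --> 0^'+] --> f (a k t) + m * (0 - t).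
    apply: cvgD; first exact: cvg_cst.
    apply: cvgMr; apply: cvgB; last exact: cvg_cst.
    exact: cvg_within.
  apply: cvg_trans; apply: near_eq_cvg; near=> s.
  rewrite -mP//; apply/andP; split; near: s;
    [exact: nbhs_right_gt|exact: nbhs_right_lt].
have e : f p = f (a k t) + m * (0 - t) := cvg_unique (@Rhausdorff R) lim1 lim2.
by rewrite e; lra.
Unshelve. all: end_near. Qed.

Lemma has_sigma_PL f : compact [set: X] ->
  (forall p, exists v, has_sigma f p v) -> PL f.
Proof.
move=> cptX fX; split.
  by move=> p; have [v /has_sigma_continuous] := fX p.
(* [F] is the filter of sufficiently large finite sets. A star around [x] has no break point but
   [x], and compactness, as a near covering along [F], yields one finite set valid for all
   points. *)
pose F : set_system (set X) := [set P | exists2 S0, finite_set S0 &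
  forall S, S0 `<=` S -> finite_set S -> P S].
have FF : Filter F.
  split.
  - by exists set0.
  - move=> P Q [S1 finS1 PS] [S2 finS2 QS]; exists (S1 `|` S2).
      by rewrite finite_setU.
    by move=> S; rewrite subUset => -[? ?] finS; split; [exact: PS|exact: QS].
  - move=> P Q PQ [S0 finS0 PS]; exists S0 => // S S0S finS; apply: PQ; exact: PS.
have cov x : [set: X] x -> \forall x' \near x & S \near F, S x' \/ affine_near f x'.
  move=> _; have [v [J [r [a [m [pa fa _]]]]]] := fX x.
  exists ([set x' | mdist x x' < r], [set S | S x]) => /=.
    split; first by apply/nbhs_mdistP; exists r => //; exact: star_ball_gt0 pa.
    exists [set x]; first exact: finite_set1.
    by move=> S xS _; exact: xS.
  move=> [x' S] /= [xr Sx]; have [->|[k Ek]] := star_ball_cover pa xr; first by left.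
  have [x0|x0] := eqVneq (mdist x x') 0.
    by left; rewrite -(mdist_positivity _ _ x0).
  right; have := mdist_ge0 x x'; set t := mdist x x' in Ek xr x0 * => t_ge0.
  rewrite Ek; have t0 : 0 < t by rewrite lt_neqAle eq_sym x0.
  have tI : 0 < t < r by rewrite t0.
  (* Off the centre, the two-armed star at [a k t] is the open interval required by [affine_near],
     with slope [m k]. *)
  have arc := star_ball_arc pa k tI; set r' := Num.min _ _ in arc.
  have [r't r'rt] : r' <= t /\ r' <= r - t.
    by split; rewrite /r' ge_min lexx// orbT.
  have r'0 := star_ball_gt0 arc.
  have cI s : s \in `]- r', r'[ -> 0 <= t + s < r.
    by rewrite in_itv/= => /andP[? ?]; apply/andP; split; lra.
  exists r', (m k), (fun s => a k (t + s)); split => //.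
  - by rewrite addr0.
  - move=> s u /cI sI /cI uI; rewrite (star_ball_dist pa)// eqxx.
    by congr `|_|; lra.
  - apply: (star_ball_nbhs arc) => [|b s sr].
      by exists 0; rewrite ?addr0//= in_itv/= oppr_lt0 r'0.
    move/andP: sr => [s0 sr]; exists (if b then s else - s); last by case: b.
    by rewrite /= in_itv/=; case: b; apply/andP; split; lra.
  - move=> s /cI sI; rewrite !fa; [lra|by rewrite t_ge0|by []].
have [S0 finS0 HS] := (compact_near_coveringP _).1 cptX _ _ _ FF cov.
exists S0; split => // q Sq.
by case: (HS S0 (@subset_refl _ _) finS0 q Logic.I).
Qed.

End PiecewiseLinear.

(** * Uniqueness of potentials *)

Section Green.
Context {R : realType} {X : metricType R}.
Implicit Types (p q x y z : X) (f g : X -> R).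

(** The divisor [y] - [z], as a function of points. *)
Definition dipole y z p : R := (p == y)%:R - (p == z)%:R.

Lemma Delta_dipole f y z : (forall p, sigma f p = dipole y z p) <->
  Delta f = (fun A => point_mass y A - point_mass z A).
Proof.
rewrite /dipole /Delta /point_mass; split=> [fyz|fyz p]; last first.
  have memE w : (w \in [set p]) = (p == w).
    by apply/idP/eqP; rewrite inE.
  by have := congr1 (@^~ [set p]) fyz; rewrite fsbig_set1 !indicE !memE.
apply/funext => A; rewrite !indicE.
have [yz|yz] := eqVneq y z.
  by rewrite -yz subrr fsbig1// => p _; rewrite fyz -yz subrr.
rewrite fsbig_mkcond (fsbigE [:: y; z])//=; last 2 first.
- by rewrite inE yz.
- move=> p _; rewrite !inE negb_or /patch fyz => /andP[/negPf -> /negPf ->].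
  by rewrite subrr if_same.
rewrite !big_cons big_nil !in_setT /patch !fyz !eqxx (negPf yz) eq_sym (negPf yz).
by do 2 case: (_ \in A); rewrite /=; lra.
Qed.

Hypotheses (cptX : compact [set: X]) (conX : connected [set: X])
  (starX : star_space (X := X)).

Lemma has_sigma_dipole_unique f g y z :
  (forall p, has_sigma f p (dipole y z p)) ->
  (forall p, has_sigma g p (dipole y z p)) ->
  forall x, g x - g z = f x - f z.
Proof.
move=> fyz gyz x.
have := @has_sigma0_cst _ _ (fun x => -1 * f x + g x) cptX conX _ x z.
rewrite !mulN1r => /(_ _)/eqP; rewrite -subr_eq0 => H; apply/eqP.
rewrite -subr_eq0; have -> : g x - g z - (f x - f z) = - f x + g x - (- f z + g z).
  lra.
apply: H => p; have := has_sigma_lin (-1) (fyz p) (gyz p).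
by rewrite mulN1r addNr.
Qed.

(** Any potential computes [j]: shifted to vanish at [z] it shows that the choice in [j] does not
    fall back on its default 0, and the chosen function differs from it by a constant. *)
Lemma jE f x y z : (forall p, has_sigma f p (dipole y z p)) ->
  j z x y = f x - f z.
Proof.
move=> fyz; rewrite /j; case: xgetP => [g _|none].
  move=> [PLg /Delta_dipole gyz gz].
  rewrite -[LHS]subr0 -gz; apply: has_sigma_dipole_unique => // p.
  have [v gv] := PL_has_sigma p starX PLg.
  by rewrite -gyz (has_sigma_sigma gv).
have fyz0 p : has_sigma (fun x => 1 * f x + - f z) p (dipole y z p).
  have := has_sigma_lin 1 (fyz p) (star_space_cst (- f z) p starX).
  by rewrite mul1r addr0.
case: (none (fun x => 1 * f x + - f z)); split.
- by apply: has_sigma_PL => // p; exists (dipole y z p).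
- by apply/Delta_dipole => p; exact: has_sigma_sigma.
- by rewrite mul1r subrr.
Qed.

End Green.

(** * Existence and reciprocity of potentials *)

Definition linear_subset {F : fieldType} {V : lmodType F} (U : set V) : Prop :=
  U 0 /\ forall (c : F) u v, U u -> U v -> U (c *: u + v).

(** Zorn's lemma gives a subspace [U] containing [W] and maximal among those avoiding [d]. Then [U]
    and [d] span [V], and [lam] is the coefficient of [d] modulo [U]. *)
Lemma separating_functional {F : fieldType} {V : lmodType F} (W : set V) (d : V) :
  linear_subset W -> ~ W d ->
  exists lam : V -> F,
    [/\ forall c u v, lam (c *: u + v) = c * lam u + lam v,
        forall w, W w -> lam w = 0 & lam d = 1].
Proof.
move=> [W0 WL] Wd.
(* Stated on W `|` U since Zorn_bigcup also considers the empty chain. *)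
pose P (U : set V) := linear_subset (W `|` U) /\ ~ (W `|` U) d.
have [Fam FamP tot|A [[[U0 UL] Ud] Amax]] := @Zorn_bigcup _ P.
  have mem u : (W `|` \bigcup_(B in Fam) B) u -> W u \/ exists2 B, Fam B & (W `|` B) u.
    by move=> [Wu|[B FB Bu]]; [left|right; exists B => //; right].
  have memI B u : Fam B -> (W `|` B) u -> (W `|` \bigcup_(B in Fam) B) u.
    by move=> FB [|Bu]; [left|right; exists B].
  split; last by move=> /mem[//|[B /FamP[_]]].
  split; first by left.
  move=> c u v /mem[Wu|[B FB Bu]] /mem[Wv|[C FC Cv]].
  - by left; exact: WL.
  - by apply: (memI C) => //; apply: (FamP _ FC).1.2 => //; left.
  - by apply: (memI B) => //; apply: (FamP _ FB).1.2 => //; left.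
  - have [BC|CB] := tot _ _ FB FC.
    + apply: (memI C) => //; apply: (FamP _ FC).1.2 => //.
      by case: Bu => [|/BC]; [left|right].
    + apply: (memI B) => //; apply: (FamP _ FB).1.2 => //.
      by case: Cv => [|/CB]; [left|right].
set U := W `|` A in U0 UL Ud.
have UZ c u : U u -> U (c *: u) by move=> Uu; rewrite -[_ *: _]addr0; exact: UL.
have ex v : exists c : F, U (v - c *: d).
  have [Uv|Uv] := pselect (U v); first by exists 0; rewrite scale0r subr0.
  (* [B] is spanned by [U] and [v], so by maximality it contains [d]. In [d = u + t *: v] the scalar
     [t] is nonzero, and solving for [v] gives the coefficient [t^-1]. *)
  pose B := [set w | exists u t, U u /\ w = u + t *: v].
  have UB u : U u -> B u by move=> Uu; exists u, 0; rewrite scale0r addr0.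
  have WB : W `|` B = B by apply/setUidPr => w Ww; apply: UB; left.
  have : ~ P B.
    apply: Amax; split; first by move=> u Au; apply: UB; right.
    move=> BA; apply: Uv; right; apply: BA; exists 0, 1.
    by rewrite scale1r add0r.
  rewrite /P WB => /not_andP[]; first case; first split.
  - exact: UB.
  - move=> c w w' [u [t [Uu ->]]] [u' [t' [Uu' ->]]].
    exists (c *: u + u'), (c * t + t'); split; first exact: UL.
    by rewrite scalerDr scalerDl scalerA addrACA.
  - move=> /contrapT[u [t [Uu dE]]]; exists t^-1.
    have t0 : t != 0.
      by apply/eqP => t0; apply: Ud; rewrite dE t0 scale0r addr0.
    rewrite dE scalerDr scalerA mulVf// scale1r opprD addrCA subrr addr0.
    by rewrite -scaleNr; exact: UZ.
have [lam lamP] := choice ex.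
have lamE v c : U (v - c *: d) -> lam v = c.
  move=> Uv; apply/eqP/negPn/negP => lc; apply: Ud.
  have := UZ (c - lam v)^-1 _ (UL (-1) _ _ Uv (lamP v)).
  have -> : -1 *: (v - c *: d) + (v - lam v *: d) = (c - lam v) *: d.
    by rewrite scaleN1r opprB scalerBl addrA subrK.
  by rewrite scalerA mulVf ?scale1r// subr_eq0 eq_sym.
exists lam; split=> [c u v|w Ww|].
- apply: lamE; have := UL c _ _ (lamP u) (lamP v).
  by rewrite scalerBr scalerA scalerDl opprD addrACA.
- by apply: lamE; rewrite scale0r subr0; left.
- by apply: lamE; rewrite scale1r subrr.
Qed.

Section Existence.
Context {R : realType} {X : metricType R}.
Implicit Types (p q x y z : X) (f g : X -> R).
Hypothesis (starX : star_space (X := X)).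

(** The tent has height 1 at [p] and descends along arm [k] to a foot at distance [eps k], with
    slope [- (eps k)^-1]. The bounds [r0] and [r1] give a radius at [p] and a margin inside the ball
    common to all arms. *)
Lemma tent_function (J : finType) p r (a : J -> R -> X) (eps : J -> R) (r0 r1 : R) :
  star_ball p r a -> 0 < r0 -> 0 <= r1 < r -> (forall k, r0 <= eps k <= r1) ->
  exists tau : X -> R,
    [/\ forall q, has_sigma tau q (\sum_k (eps k)^-1 * dipole p (a k (eps k)) q),
        tau p = 1 & forall q, r <= mdist p q -> tau q = 0].
Proof.
move=> pa r00 /andP[r1_ge0 r1r] epsP.
have eps0 k : 0 < eps k by case/andP: (epsP k) => ? _; lra.
have epsr k : eps k < r by case/andP: (epsP k) => _ ?; lra.
have epsI k : 0 < eps k < r by rewrite eps0 epsr.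
have epsd k : mdist p (a k (eps k)) = eps k.
  by apply: (star_ball_dist0 pa); rewrite epsr ltW.
have r_gt0 := star_ball_gt0 pa.
(* At [p] every arm matches and the sum would count them all, hence the separate case; elsewhere at
   most one term is nonzero. *)
pose tau q : R := if q == p then 1 else
  \sum_k (q == a k (mdist p q))%:R *
    (if mdist p q < r then Num.max 0 (1 - mdist p q / eps k) else 0).
have taup : tau p = 1 by rewrite /tau eqxx.
have taur q : r <= mdist p q -> tau q = 0.
  rewrite /tau => rq; case: eqP => [qp|_].
    by move: rq; rewrite qp mdistxx leNgt r_gt0.
  by rewrite big1// => k _; rewrite ltNge rq mulr0.
have taua k t : 0 <= t < r -> tau (a k t) = Num.max 0 (1 - t / eps k).
  move=> /andP[]; rewrite le_eqVlt => /predU1P[<- _|t0 tr].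
    by rewrite (star_ball0 pa) taup mul0r subr0 max_r.
  have tI : 0 < t < r by rewrite t0.
  have tI' : 0 <= t < r by rewrite ltW.
  rewrite /tau (star_ball_dist0 pa)// tr; case: eqP => [ap|_].
    by have := star_ball_dist0 pa k tI'; rewrite ap mdistxx => e; exfalso; lra.
  rewrite (bigD1 k)//= eqxx mul1r big1 ?addr0// => l lk.
  case: eqP => [|_]; last by rewrite mul0r.
  by case/(star_ball_inj pa tI tI') => kl; rewrite kl eqxx in lk.
have tau1 k t : 0 <= t <= eps k -> tau (a k t) = 1 - t / eps k.
  move=> /andP[t0 te]; rewrite taua ?t0 ?(le_lt_trans te)//.
  by apply: max_r; rewrite subr_ge0 ler_pdivrMr// mul1r.
have tau2 k t : eps k <= t < r -> tau (a k t) = 0.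
  move=> /andP[te tr]; rewrite taua ?tr ?andbT; last by apply: le_trans te; exact: ltW.
  by apply: max_l; rewrite subr_le0 ler_pdivlMr// mul1r.
exists tau; split=> // q.
have [->|qp] := eqVneq q p.
  exists J, (Num.min r0 r), a, (fun k => - (eps k)^-1); split.
  - by apply: (star_ball_le pa); rewrite lt_min r00 r_gt0 ge_min lexx orbT.
  - move=> k t; rewrite lt_min => /and3P[t0 tr0 _].
    rewrite taup tau1; first by rewrite mulNr mulrC.
    by rewrite t0/=; case/andP: (epsP k) => ? _; lra.
  - rewrite sumrN opprK; apply: eq_bigr => k _; rewrite /dipole eqxx.
    case: eqP => [e|_]; last by rewrite subr0 mulr1.
    by have := eps0 k; rewrite -(epsd k) -e mdistxx ltxx.
have mp0 : 0 < mdist p q by rewrite mdist_gt0 eq_sym.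
have [rq|qr] := lerP r (mdist p q).
  have -> : \sum_k (eps k)^-1 * dipole p (a k (eps k)) q = 0.
    rewrite big1// => k _; rewrite /dipole (negPf qp); case: eqP => [e|_]; last lra.
    by exfalso; move: rq; rewrite e epsd; have := epsr k; lra.
  apply: has_sigma_near (star_space_cst 0 q starX).
  (* Points this close to [q] are farther than [r1] from [p], hence beyond all the feet. *)
  apply/nbhs_mdistP; exists (r - r1); first by rewrite subr_gt0.
  move=> x qx; have px : r1 < mdist p x.
    by have := metric_triangle p x q; rewrite (metric_sym x); lra.
  have [/taur //|xr] := lerP r (mdist p x).
  have [xp|[k ->]] := star_ball_cover pa xr.
    by move: px; rewrite xp mdistxx; lra.
  by rewrite tau2// xr andbT; case/andP: (epsP k) => _ ?; lra.
have [/eqP|[l ql]] := star_ball_cover pa qr; first by rewrite (negPf qp).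
move: mp0 qr ql; set d := mdist p q => d0 dr ql.
have dI : 0 < d < r by rewrite d0.
pose arm (b : bool) (s : R) := a l (if b then d + s else d - s).
have arc : star_ball (a l d) _ arm := star_ball_arc pa l dI.
set r' := Num.min _ _ in arc; have r'0 := star_ball_gt0 arc.
have [r'd r'rd] : r' <= d /\ r' <= r - d by split; rewrite /r' ge_min lexx// orbT.
have -> : \sum_k (eps k)^-1 * dipole p (a k (eps k)) q =
    - (if d == eps l then (eps l)^-1 else 0).
  rewrite (bigD1 l)//= /dipole (negPf qp) sub0r big1 ?addr0; last first.
    move=> k kl; rewrite sub0r; case: eqP => [|_]; last by rewrite oppr0 mulr0.
    rewrite ql => /(star_ball_inj pa dI)[]; first by rewrite epsr ltW.
    by move=> lk; rewrite lk eqxx in kl.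
  have -> : (q == a l (eps l)) = (d == eps l).
    rewrite ql; apply/eqP/eqP => [|->//].
    by case/(star_ball_inj pa dI) => //; rewrite epsr ltW.
  by case: eqP => _; rewrite ?mulrN ?mulr1 ?mulr0 ?oppr0.
(* On its arm [q] is on the slope of the tent, beyond its foot, or at the foot, the only case with a
   nonzero Laplacian. *)
rewrite ql; have [de|ed|de] := ltgtP d (eps l).
- exists bool, (Num.min r' (eps l - d)), arm,
    (fun b : bool => if b then - (eps l)^-1 else (eps l)^-1); split.
  + by apply: (star_ball_le arc); rewrite lt_min r'0 subr_gt0 de ge_min lexx.
  + move=> b t; rewrite lt_min => /and3P[t0 tr te].
    rewrite /arm !tau1; [by case: b; lra|by rewrite ltW//ltW|].
    by case: b; apply/andP; split; lra.
  + by rewrite big_bool/= addNr.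
- exists bool, (Num.min r' (d - eps l)), arm, (fun=> 0); split.
  + by apply: (star_ball_le arc); rewrite lt_min r'0 subr_gt0 ed ge_min lexx.
  + move=> b t; rewrite lt_min => /and3P[t0 tr te].
    rewrite /arm !tau2; [by rewrite mul0r addr0|by rewrite dr ltW|].
    by case: b; apply/andP; split; lra.
  + by rewrite big_bool/= addr0.
- exists bool, r', arm, (fun b : bool => if b then 0 else (eps l)^-1); split.
  + exact: arc.
  + move=> b t /andP[t0 tr]; rewrite /arm (tau2 l d) ?dr ?de ?lexx// add0r.
    case: b.
      by rewrite tau2 ?mul0r//; apply/andP; split; lra.
    rewrite tau1; last by apply/andP; split; lra.
    by rewrite mulrBl divff ?gt_eqF//; lra.
  + by rewrite big_bool/= add0r.
Qed.

(** Existence and reciprocity are one membership, that of [d y - d z] in the subspace [W] of pairs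
    formed by the Laplacian of [g] and the number [g y' - g z']. *)
Lemma dipole_potential f y' z' y z : compact [set: X] -> connected [set: X] ->
  (forall p, has_sigma f p (dipole y' z' p)) ->
  exists g, (forall p, has_sigma g p (dipole y z p)) /\
    g y' - g z' = f y - f z.
Proof.
move=> cptX conX fyz.
(* A vector of V is a divisor, the values at Some q, together with a number, the
   value at None; d p is the point p together with f p. *)
pose V := option X -> R^o.
pose W := [set w : V | exists2 g,
  forall p, has_sigma g p (w (Some p)) & g y' - g z' = w None].
have WL : linear_subset W.
  split.
    exists (fun=> 0); last by rewrite subrr.
    by move=> p; exact: star_space_cst.
  move=> c mu nu [g gmu gs] [h hnu ht]; exists (fun x => c * g x + h x).
    by move=> p; exact: has_sigma_lin.
  have -> : (c *: mu + nu) None = c * mu None + nu None by [].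
  by rewrite -gs -ht; lra.
pose d p : V := fun o => if o is Some q then (q == p)%:R else f p.
have [[g gD Eg]|WD] := pselect (W (d y - d z)); first by exists g.
have [lam [lamL lamW lamD]] := separating_functional WL WD.
have lam0 : lam 0 = 0.
  by have := lamL 1 0 0; rewrite scale1r addr0 mul1r; lra.
have lamB u v : lam (u - v) = lam u - lam v.
  by rewrite addrC -scaleN1r lamL mulN1r addrC.
have lamS (J : finType) (c : J -> R) (u : J -> V) :
    lam (\sum_k c k *: u k) = \sum_k c k * lam (u k).
  elim/big_rec2: _ => [//|k s t _ <-]; exact: lamL.
pose h p := lam (d p).
suff hc p : has_sigma h p 0.
  have := has_sigma0_cst cptX conX hc y z; move: lamD.
  by rewrite lamB /h => + e; rewrite e subrr => /eqP; rewrite eq_sym oner_eq0.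
have [J [r [a [m [pa fa mE]]]]] := fyz p.
have [s s0 sP] := finite_set_separated p (finite_set2 y' z').
pose rho := Num.min r s.
have rho0 : 0 < rho by rewrite lt_min (star_ball_gt0 pa).
have {}pa : star_ball p rho a by apply: (star_ball_le pa); rewrite rho0 ge_min lexx.
have {}fa k t : 0 <= t < rho -> f (a k t) = f p + m k * t.
  by rewrite lt_min => /and3P[t0 tr _]; rewrite fa ?t0.
have {}sP q : (q = y' \/ q = z') -> q <> p -> rho <= mdist p q.
  move=> qyz qp; rewrite leNgt lt_min; apply/negP => /andP[_ /(sP _ qyz)].
  exact: qp.
(* A mean value property of [h]: the vector killed by [lam] belongs to the tent. Its number is minus
   the sum of the slopes of [f] at [p], that is [dipole y' z' p], and [tau y' - tau z'] has the same
   value because [tau] is 1 at [p] and 0 at any of [y'], [z'] other than [p]. *)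
have mvp (eps : J -> R) r0 r1 : 0 < r0 -> r1 < rho -> (forall k, r0 <= eps k <= r1) ->
    0 <= r1 -> \sum_k (eps k)^-1 * (h p - h (a k (eps k))) = 0.
  move=> r00 r1r epsP r10.
  have [|tau [tauD taup taur]] := tent_function pa r00 _ epsP; first by rewrite r10.
  suff : lam (\sum_k (eps k)^-1 *: (d p - d (a k (eps k)))) = 0.
    by move=> e; rewrite -[RHS]e lamS; apply: eq_bigr => k _; rewrite lamB.
  apply: lamW; exists tau.
    by move=> q; rewrite fct_sumE; exact: tauD.
  have tauE q : q = y' \/ q = z' -> tau q = (p == q)%:R.
    move=> qyz; have [<-|/eqP pq] := eqVneq p q; first by rewrite taup.
    by apply: taur; apply: sP => // /esym.
  rewrite !tauE; [|by right|by left].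
  rewrite fct_sumE; transitivity (- \sum_k m k); first by rewrite -mE.
  rewrite -sumrN; apply: eq_bigr => k _.
  have -> : ((eps k)^-1 *: (d p - d (a k (eps k)))) None =
    (eps k)^-1 * (f p - f (a k (eps k))) by [].
  have /andP[? ?] := epsP k; have ek : 0 < eps k by lra.
  rewrite fa; last by apply/andP; split; lra.
  by rewrite opprD addNKr mulrN mulrCA mulVf ?mulr1// gt_eqF.
have mvp2 : \sum_k (rho / 2)^-1 * (h p - h (a k (rho / 2))) = 0.
  by apply: (mvp _ (rho / 2) (rho / 2)) => [||k|]; [lra|lra|rewrite lexx|lra].
exists J, rho, a, (fun k => (h (a k (rho / 2)) - h p) / (rho / 2)); split => //.
- move=> k t /andP[]; rewrite le_eqVlt => /predU1P[<- _|t0 tr].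
    by rewrite (star_ball0 pa) mulr0 addr0.
  (* Moving the foot on arm [k] alone and comparing with [mvp2] isolates that arm: the slope of [h]
     from [p] to [a k t] is independent of [t]. *)
  pose eps l := if l == k then t else rho / 2.
  have := mvp eps (Num.min t (rho / 2)) (Num.max t (rho / 2)).
  rewrite lt_min gt_max le_max t0 tr divr_gt0// (ltW t0)/=.
  have -> : rho / 2 < rho by lra.
  move=> /(_ isT isT _ isT).
  have epsI l : Num.min t (rho / 2) <= eps l <= Num.max t (rho / 2).
    by rewrite /eps ge_min le_max; case: eqP => _; rewrite lexx ?orbT.
  move=> /(_ epsI); rewrite (bigD1 k)//=.
  rewrite (eq_bigr (fun l => (rho / 2)^-1 * (h p - h (a l (rho / 2))))); last first.
    by move=> l /negPf lk; rewrite /eps lk.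
  move=> e1; have := mvp2; rewrite (bigD1 k)//= => e2.
  have := addIr _ (etrans e1 (esym e2)); rewrite /eps eqxx => e.
  have : t * (t^-1 * (h p - h (a k t))) =
    t * ((rho / 2)^-1 * (h p - h (a k (rho / 2)))) by rewrite e.
  by rewrite mulrA divff ?gt_eqF// => e'; lra.
- rewrite -sumrN -[LHS]mvp2; apply: eq_bigr => k _.
  by rewrite -mulNr opprB mulrC.
Qed.

End Existence.

(** * Edges and their contraction *)

Section Paths.
Context {R : realType} {X : metricType R}.
Implicit Types (p q x y : X) (A : set X).

(** The subdivision of a path into a single step already contributes the distance of its ends. *)
Lemma mdist_le_path_dist A x y : ((mdist x y)%:E <= path_dist A x y)%E.
Proof.
apply: le_ereal_inf_tmp => _ [g [_ _ <- <-] <-].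
apply: ereal_sup_ubound; exists [:: 1]; last by rewrite big_ord1.
by split; rewrite /= ?ltr01 ?eqxx.
Qed.

Lemma lipschitz_within_continuous (g : R -> X) (D : set R) :
  (forall s t, D s -> D t -> mdist (g s) (g t) <= `|s - t|) ->
  {within D, continuous g}.
Proof.
move=> gD; apply/subspace_continuousP => s Ds.
apply/metricType_numDomainType.cvgrPdist_lt => /= eps eps0.
rewrite near_withinE; apply/nbhs_ballP; exists eps => // t st Dt.
exact: le_lt_trans (gD _ _ Ds Dt) st.
Qed.

Lemma connected_arc (g : R -> X) (i : interval R) :
  {in i &, forall s t, mdist (g s) (g t) <= `|s - t|} ->
  connected (g @` [set` i]).
Proof.
move=> gi; apply: connected_continuous_connected.
  by apply/connected_intervalP; exact: interval_is_interval.
exact: lipschitz_within_continuous.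
Qed.

Lemma star_ball_arm_connected (J : finType) p r (a : J -> R -> X) (i : interval R) k :
  star_ball p r a -> (forall t, t \in i -> 0 <= t < r) ->
  connected (a k @` [set` i]).
Proof.
move=> pa iP; apply: connected_arc => s t /iP sI /iP tI.
by rewrite (star_ball_dist pa)// eqxx.
Qed.

Lemma star_ball_connected (J : finType) p r (a : J -> R -> X) :
  star_ball p r a -> connected [set q | mdist p q < r].
Proof.
move=> pa; have r0 := star_ball_gt0 pa.
(* [None] accounts for [p] itself, which lies on no arm when [J] is empty. *)
pose A (o : option J) := if o is Some k then a k @` `[0, r[%classic else [set p].
have -> : [set q | mdist p q < r] = \bigcup_(o in setT) A o.
  apply/seteqP; split=> [q /= qr|q [[k|] _]/=].
  - have [->|[k qk]] := star_ball_cover pa qr; first by exists None.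
    by exists (Some k) => //; exists (mdist p q); rewrite //= in_itv/= mdist_ge0.
  - move=> [t]; rewrite /= in_itv/= => tr <-; rewrite (star_ball_dist0 pa)//.
    by case/andP: tr.
  - by move=> ->; rewrite mdistxx.
apply: bigcup_connected.
  exists p => -[k|] _ //=; exists 0; last exact: star_ball0 pa _.
  by rewrite /= in_itv/= lexx.
move=> [k|] _ /=; last exact: connected1.
by apply: (star_ball_arm_connected pa) => t; rewrite in_itv.
Qed.

End Paths.

Section Edges.
Context {R : realType} {T : metricType R} (e : edge_segment T).
Hypothesis starT : star_space (X := T).

(** In the metric of [T] the parametrization is only 1-Lipschitz, as the path metric of the edge
    dominates it. Injectivity is inherited from the path metric. *)
Lemma edge_param : exists (L : R) (c : R -> T), [/\ 0 < L,
  c 0 = eminus e /\ c L = eplus e, c @` `[0, L] = edge_set e,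
  {in `[0, L] &, forall s t, mdist (c s) (c t) <= `|s - t|} &
  {in `[0, L] &, injective c}].
Proof.
have [L [c [L0 [cE cd] c0 cL]]] := edge_endsP e; exists L, c; split => //.
  by move=> s t sI tI; rewrite -lee_fin -(cd _ _ sI tI) mdist_le_path_dist.
move=> s t sI tI cst; apply/eqP; rewrite -subr_eq0 -normr_eq0; apply/eqP.
apply: EFin_inj; rewrite -(cd _ _ sI tI) cst (cd _ _ tI tI).
by rewrite subrr normr0.
Qed.

Lemma edge_ends : [/\ edge_set e (eminus e), edge_set e (eplus e) & eminus e <> eplus e].
Proof.
have [L [c [L0 [<- <-] <- _ cinj]]] := edge_param.
have I0 : 0 \in `[0, L] by rewrite in_itv/= lexx ltW.
have IL : L \in `[0, L] by rewrite in_itv/= lexx ltW.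
split; [by exists 0|by exists L|].
by move=> /(cinj _ _ I0 IL) L0'; move: L0; rewrite -L0' ltxx.
Qed.

(** A vertex inside [e] would split the component [C] into two relatively closed pieces; [C] would
    lie in one of them, and so would its closure [e], missing an end. So an interior point has a
    star ball avoiding [V] and both ends; being connected and meeting [C], this ball lies in [C]. *)
Lemma edge_interior_open : open (edge_interior e).
Proof.
have [V [x [[finV _ _] Vx eE]]] := edge_setP e.
have [L [c [L0 [c0 cL] ce clip cinj]]] := edge_param.
set C := connected_component (~` V) x in eE.
have Cx : C x by exact: connected_component_refl.
have CV : C `<=` ~` V by exact: connected_component_sub.
have Ccon : connected C by exact: component_connected.
have arc_closed u v : 0 <= u -> v <= L -> closed (c @` `[u, v]).
  move=> u0 vL; apply: compact_closed; first exact: metric_hausdorff.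
  apply: continuous_compact; last exact: segment_compact.
  apply: lipschitz_within_continuous => s t.
  rewrite /= !in_itv/= => /andP[? ?] /andP[? ?].
  by apply: clip; rewrite in_itv/=; apply/andP; split; lra.
have intV p : edge_interior e p -> ~ V p.
  move=> [ep [pm pp]] Vp; move: ep; rewrite -ce => -[s sI cs].
  have s0 : 0 < s.
    move: sI; rewrite /= in_itv/= => /andP[]; rewrite le_eqVlt => /predU1P[s0|//].
    by rewrite -cs -s0 c0 in pm.
  have sL : s < L.
    move: sI; rewrite /= in_itv/= => /andP[_]; rewrite le_eqVlt => /predU1P[s0'|//].
    by rewrite -cs s0' cL in pp.
  have Ce : C `<=` edge_set e by rewrite eE; exact: subset_closure.
  have Cs q : C q -> q <> c s by move=> /CV Vq qs; apply: Vq; rewrite qs cs.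
  pose A1 := c @` `[0, s]; pose A2 := c @` `[s, L].
  have A1c : closed A1 by apply: arc_closed => //; exact: ltW.
  have A2c : closed A2 by apply: arc_closed => //; exact: ltW.
  have A12 q : C q -> A1 q \/ A2 q.
    move=> /Ce; rewrite -ce => -[t]; rewrite /= in_itv/= => /andP[t0 tL] <-.
    by have [ts|st] := leP t s; [left|right]; exists t => //=;
      rewrite in_itv/= ?t0 ?ts// ltW.
  have A1A2 q : C q -> A1 q -> A2 q -> False.
    move=> Cq [t]; rewrite /= in_itv/= => /andP[t0 ts] ct [u].
    rewrite /= in_itv/= => /andP[su uL] cu; apply: (Cs _ Cq).
    have tu : t = u.
      by apply: cinj; rewrite ?ct ?cu// in_itv/=; apply/andP; split; lra.
    by rewrite -ct; congr c; lra.
  have [CA1|CA1] := pselect (exists q, C q /\ A1 q).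
    have CE : C `&` A1 = C.
      apply: Ccon; [by have [q ?] := CA1; exists q| |by exists A1].
      exists (~` A2); first exact: closed_openC.
      apply/seteqP; split=> q [Cq Aq]; split => //; first exact: A1A2 Aq.
      by case: (A12 _ Cq).
    have : closure C `<=` A1.
      by apply: (subset_trans _ A1c); apply: closure_subset => q; rewrite -CE => -[].
    rewrite -eE => /(_ (eplus e)) /(_ _)[|t]; first by case: edge_ends.
    rewrite /= in_itv/= => /andP[t0 ts]; rewrite -cL => /cinj tL.
    have : t = L by apply: tL; rewrite in_itv/=; apply/andP; split; lra.
    lra.
  have : closure C `<=` A2.
    apply: (subset_trans _ A2c); apply: closure_subset => q Cq.
    by case: (A12 _ Cq) => // A1q; case: CA1; exists q.
  rewrite -eE => /(_ (eminus e)) /(_ _)[|t]; first by case: edge_ends.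
  rewrite /= in_itv/= => /andP[st tL]; rewrite -c0 => /cinj t0.
  have : t = 0 by apply: t0; rewrite in_itv/=; apply/andP; split; lra.
  lra.
rewrite openE => p ip; have Vp := intV p ip.
have [J [r [a pa]]] := starT p.
have finV' : finite_set (V `|` [set eminus e; eplus e]).
  by rewrite finite_setU; split => //; exact: finite_set2.
have [s s0 Vs] := finite_set_separated p finV'.
have {}pa : star_ball p (Num.min r s) a.
  by apply: (star_ball_le pa); rewrite lt_min (star_ball_gt0 pa) s0 ge_min lexx.
set r' := Num.min r s in pa.
have Bsep q : mdist p q < r' -> (V `|` [set eminus e; eplus e]) q -> q = p.
  by rewrite lt_min => /andP[_ qs] /Vs; exact.
apply/nbhs_mdistP; exists r'; first exact: star_ball_gt0 pa.
have BC : [set q | mdist p q < r'] `<=` C.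
  have [ep _] := ip; move: ep; rewrite eE => clp.
  have [q [Cq qr]] : C `&` [set q | mdist p q < r'] !=set0.
    by apply: clp; apply/nbhs_mdistP; exists r' => //; exact: star_ball_gt0 pa.
  rewrite /C (same_connected_component Cq); apply: connected_component_max => //.
    by move=> w wr Vw; apply: Vp; rewrite -(Bsep w)//; left.
  exact: star_ball_connected pa.
move=> q qr; split; first by rewrite eE; apply: subset_closure; exact: BC.
have [_ [pm pp]] := ip.
by split=> qe; [apply: pm|apply: pp]; rewrite -(Bsep q qr)//; right; [left|right].
Qed.

End Edges.

(** * The collapse map and the Laplacian on the quotient *)

Section Contraction.
Context {R : realType} {T : metricType R} (e : edge_segment T).
Hypotheses (starT : star_space (X := T)) (cptT : compact [set: T]).

(* Qualified because mathcomp-analysis also has a notion called contraction. *)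
Lemma collapse_surj (c : Defs.contraction e) : exists x, collapse e x = c.
Proof. by exists (repr (c : {eq_quot edge_equivRel e})); rewrite /collapse reprK. Qed.

Lemma collapse_in_edge x : collapse e x = collapse e (eminus e) <-> edge_set e x.
Proof.
have [em _ _] := edge_ends e; split=> [/collapse_eq[->//|[]//]|ex].
by apply/collapse_eq; right.
Qed.

Lemma collapse_continuous : continuous (collapse e).
Proof.
move=> p; apply: (@mdist_lipschitz_continuous _ _ _ _ 1); apply: nearW => q.
by rewrite mul1r collapse_dist /pre_contraction_dist ge_min lexx.
Qed.

Lemma collapse_setT : collapse e @` [set: T] = [set: Defs.contraction e].
Proof.
by apply/seteqP; split=> // c _; have [x <-] := collapse_surj c; exists x.
Qed.

Lemma contraction_compact : compact [set: Defs.contraction e].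
Proof.
rewrite -collapse_setT; apply: continuous_compact => //.
by apply: continuous_subspaceT => x; exact: collapse_continuous.
Qed.

Lemma contraction_connected : connected [set: T] -> connected [set: Defs.contraction e].
Proof.
move=> conT; rewrite -collapse_setT; apply: connected_continuous_connected => //.
by apply: continuous_subspaceT => x; exact: collapse_continuous.
Qed.

Lemma edge_dist_continuous : continuous (edge_dist e : T -> R).
Proof.
move=> p; apply: (@mdist_lipschitz_continuous _ _ R^o _ 1); apply: nearW => q.
have -> (x y : R^o) : mdist x y = `|y - x| by [].
rewrite mul1r ler_norml.
have := edge_dist_lipschitz e p q; have := edge_dist_lipschitz e q p.
by rewrite (metric_sym q p) => ? ?; apply/andP; split; lra.
Qed.

(** On the compact complement of [U], if nonempty, the distance to [e] attains a minimum, positive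
    because [e] is closed. *)
Lemma edge_tube (U : set T) : open U -> edge_set e `<=` U ->
  exists2 d, 0 < d & forall x, edge_dist e x < d -> U x.
Proof.
move=> oU eU; have [/eqP U0|/set0P U0] := boolP (~` U == set0).
  exists 1 => // x _; apply: contrapT => Ux.
  by have : (~` U) x by []; rewrite U0.
have cU : compact (~` U).
  by apply: subclosed_compact cptT _ => //; exact: open_closedC.
have [c] := compact_EVT_min U0 cU (continuous_subspaceT edge_dist_continuous).
rewrite inE => Uc cmin; exists (edge_dist e c).
  rewrite lt_neqAle edge_dist_ge0 andbT eq_sym; apply/eqP => /edge_dist0_in/eU.
  exact: Uc.
move=> x xc; apply: contrapT => Ux; move: xc.
by rewrite ltNge cmin// inE.
Qed.

Lemma has_sigma_collapse_off (F : Defs.contraction e -> R) p v : ~ edge_set e p ->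
  has_sigma (F \o collapse e) p v -> has_sigma F (collapse e p) v.
Proof.
move=> ep [J [r [a [m [pa fa ->]]]]]; pose D := edge_dist e p.
have D0 : 0 < D.
  by rewrite lt_neqAle edge_dist_ge0 andbT eq_sym; apply/eqP => /edge_dist0_in.
(* Two points within [D / 4] of [p] are less than [D / 2] apart and each farther than [3 / 4 * D]
   from [e], so a detour through [e] never shortens their distance: the collapse is isometric
   there. *)
pose r' := Num.min r (D / 4).
have r'0 : 0 < r' by rewrite lt_min (star_ball_gt0 pa) divr_gt0.
have [r'r r'D] : r' <= r /\ r' <= D / 4 by rewrite !ge_min !lexx orbT.
have {}pa : star_ball p r' a by apply: (star_ball_le pa); rewrite r'0.
have D_le x : mdist p x < r' -> 3 / 4 * D < edge_dist e x.
  by move=> px; have := edge_dist_lipschitz e p x; rewrite -/D; lra.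
have dE x y : mdist p x < r' -> mdist p y < r' ->
    mdist (collapse e x) (collapse e y) = mdist x y.
  move=> px py; rewrite collapse_dist /pre_contraction_dist min_l//.
  have := D_le _ px; have := D_le _ py.
  by have := metric_triangle x p y; rewrite (metric_sym x p); lra.
exists J, r', (fun k t => collapse e (a k t)), m; split => //.
- split => //; first by move=> k; rewrite (star_ball0 pa).
  + move=> k l s t sr tr; rewrite dE ?(star_ball_dist0 pa) ?(star_ball_dist pa)//.
      by case/andP: sr.
    by case/andP: tr.
  + move=> c; have [x <-] := collapse_surj c.
    rewrite collapse_dist /pre_contraction_dist gt_min => /orP[px|]; last first.
      by rewrite -/D; have := edge_dist_ge0 e x => ? ?; exfalso; lra.
    rewrite min_l; last by have := D_le _ px; rewrite -/D; lra.
    by have [->|[k xk]] := star_ball_cover pa px; [left|right; exists k; rewrite -xk].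
- by move=> k t /andP[t0 tr]; apply: fa; rewrite t0 (lt_le_trans tr).
Qed.

(** What remains of a star at an end [u] of [e] without its arms in [e]. The distance to [e] grows
    at unit speed along an arm, which thus becomes an arm at the collapsed point. *)
Definition outer_star u (J : finType) (r : R) (a : J -> R -> T) : Prop :=
  [/\ 0 < r, forall k, a k 0 = u,
      forall k l (s t : R), 0 <= s < r -> 0 <= t < r ->
        mdist (a k s) (a l t) = if k == l then `|s - t| else s + t,
      forall k t, 0 <= t < r -> edge_dist e (a k t) = t
    & forall q, mdist u q < r -> edge_set e q \/ exists k, q = a k (mdist u q)].

(** The open arm is connected and contains no end of [e]. Its trace on [e] is therefore its trace on
    the interior of [e], relatively open as well as closed. *)
Lemma edge_arm (J : finType) u r (a : J -> R -> T) k : star_ball u r a ->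
  edge_set e u ->
  (forall q, mdist u q < r -> q = eminus e \/ q = eplus e -> q = u) ->
  (exists2 t, 0 < t < r & edge_set e (a k t)) ->
  forall t, 0 < t < r -> edge_set e (a k t).
Proof.
move=> ua eu sep [t0 t0r et0].
have notend t : 0 < t < r -> ~ (a k t = eminus e \/ a k t = eplus e).
  move=> tI end_t; have tI' : 0 <= t < r by case/andP: tI => /ltW -> ->.
  have := sep _ _ end_t; rewrite (star_ball_dist0 ua)// => /(_ _)/=.
  case/andP: (tI) => t_gt0 tr /(_ tr) au; have := star_ball_dist0 ua k tI'.
  by rewrite au mdistxx => t00; move: t_gt0; rewrite -t00 ltxx.
pose A := a k @` `]0, r[.
have Acon : connected A.
  by apply: (star_ball_arm_connected ua) => t; rewrite in_itv/= => /andP[/ltW -> ->].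
have intE : A `&` edge_interior e = A `&` edge_set e.
  apply/seteqP; split=> q [Aq]; first by case.
  move=> eq; split=> //; split => //; move: Aq => -[t].
  rewrite /= in_itv/= => tI tq; have := notend _ tI; rewrite tq.
  by move=> /not_orP.
have AE : A `&` edge_set e = A.
  apply: Acon.
  - by exists (a k t0); split => //; exists t0 => //; rewrite /= in_itv.
  - by exists (edge_interior e); [exact: edge_interior_open|].
  - by exists (edge_set e); first exact: edge_set_closed.
move=> t tI; have : A (a k t) by exists t => //; rewrite /= in_itv.
by rewrite -AE => -[].
Qed.

(* An arm at an end of e lies either in e, where f is constant, or outside. *)
Lemma edge_end_outer_star (f : T -> R) u v : u = eminus e \/ u = eplus e ->
  (forall q, edge_set e q -> f q = f u) -> has_sigma f u v ->
  exists (J : finType) r (a : J -> R -> T) (m : J -> R),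
    [/\ outer_star u r a,
        forall k t, 0 <= t < r -> f (a k t) = f u + m k * t
      & v = - \sum_k m k].
Proof.
move=> u_end fe [J [r [a [m [ua fa ->]]]]].
have [em ep emp] := edge_ends e.
have eu : edge_set e u by case: u_end => ->.
have [s s0 sep] := finite_set_separated u (finite_set2 (eminus e) (eplus e)).
pose r' := Num.min r s; have r'0 : 0 < r' by rewrite lt_min (star_ball_gt0 ua).
have {}ua : star_ball u r' a by apply: (star_ball_le ua); rewrite r'0 ge_min lexx.
have {}fa k t : 0 <= t < r' -> f (a k t) = f u + m k * t.
  by rewrite lt_min => /and3P[t0 tr _]; rewrite fa ?t0.
have {}sep q : mdist u q < r' -> q = eminus e \/ q = eplus e -> q = u.
  by rewrite lt_min => /andP[_ qs] qe; exact: sep qe qs.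
pose inner k := `[< exists2 t, 0 < t < r' & edge_set e (a k t) >].
have innerP k t : inner k -> 0 < t < r' -> edge_set e (a k t).
  by move=> /asboolP ik; exact: edge_arm ua eu sep ik t.
have outerP k t : ~~ inner k -> 0 < t < r' -> ~ edge_set e (a k t).
  by move=> /asboolP ik tI eak; apply: ik; exists t.
(* The radius is halved so that a point of [e] closer to [a k t] than [u] would still lie in the
   ball where distances are those of the star. *)
exists {k : J | ~~ inner k}, (r' / 2), (fun k => a (val k)), (fun k => m (val k)).
split.
- split.
  + by rewrite divr_gt0.
  + by move=> k; exact: star_ball0 ua _.
  + move=> k l t w /andP[t0 tr] /andP[w0 wr].
    by rewrite (star_ball_dist ua) ?(inj_eq val_inj)//; apply/andP; split; lra.
  + move=> [k ik] t /andP[t0 tr] /=.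
    have tI : 0 <= t < r' by apply/andP; split; lra.
    apply/le_anti/andP; split.
      by rewrite -[leRHS](star_ball_dist0 ua k tI) metric_sym edge_dist_le.
    apply: lb_le_inf; first by have [] := edge_dist_has_inf e (a k t).
    move=> _ [q eq <-]; rewrite leNgt; apply/negP => aqt.
    have uq : mdist u q < r'.
      by have := metric_triangle u (a k t) q; rewrite (star_ball_dist0 ua)//; lra.
    have [qu|[l ql]] := star_ball_cover ua uq.
      by move: aqt; rewrite qu metric_sym (star_ball_dist0 ua)// ltxx.
    have [q0|q0] := eqVneq (mdist u q) 0.
      move: aqt; rewrite -(mdist_positivity _ _ q0) metric_sym.
      by rewrite (star_ball_dist0 ua)// ltxx.
    have q_gt0 : 0 < mdist u q by rewrite lt_neqAle eq_sym q0 mdist_ge0.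
    have kl : k == l = false.
      apply/negP => /eqP kl; apply: (outerP _ (mdist u q) ik); first by rewrite q_gt0.
      by rewrite kl -ql.
    by move: aqt; rewrite ql (star_ball_dist ua) ?kl ?mdist_ge0//; lra.
  + move=> q qr; have uq : mdist u q < r' by lra.
    have [->|[k qk]] := star_ball_cover ua uq; first by left.
    have [ik|ik] := boolP (inner k); last by right; exists (exist _ k ik).
    have [q0|q0] := eqVneq (mdist u q) 0.
      by left; rewrite -(mdist_positivity _ _ q0).
    left; rewrite qk; apply: innerP => //.
    by rewrite uq andbT lt_neqAle eq_sym q0 mdist_ge0.
- by move=> k t /andP[t0 tr]; apply: fa; apply/andP; split; lra.
- congr (- _); rewrite -(big_sub (fun k => ~~ inner k) m) [RHS]big_mkcond/=.
  apply: eq_bigr => k _; case: ifPn => //.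
  rewrite -topredE/= negbK => ik.
  have I : 0 < r' / 2 < r' by apply/andP; split; lra.
  have I' : 0 <= r' / 2 < r' by apply/andP; split; lra.
  have := fa k _ I'; rewrite fe; last exact: innerP.
  move=> /eqP; rewrite addrC -subr_eq subrr eq_sym mulf_eq0 => /orP[/eqP//|/eqP].
  lra.
Qed.

(** The arms at the collapsed point are the outer arms at [eminus e] together with those at
    [eplus e], so the two sums of slopes add up. *)
Lemma has_sigma_collapse_edge (F : Defs.contraction e -> R) v w :
  has_sigma (F \o collapse e) (eminus e) v ->
  has_sigma (F \o collapse e) (eplus e) w ->
  has_sigma F (collapse e (eminus e)) (v + w).
Proof.
have [em ep emp] := edge_ends e; move=> Fv Fw.
have Fe u q : edge_set e u -> edge_set e q -> (F \o collapse e) q = (F \o collapse e) u.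
  by move=> eu eq; rewrite /=; congr F; apply/collapse_eq; right.
have [J1 [r1 [a [m [[r10 a0 ad ae ac] fa ->]]]]] :=
  edge_end_outer_star (or_introl erefl) (Fe _ ^~ em) Fv.
have [J2 [r2 [b [n [[r20 b0 bd be bc] fb ->]]]]] :=
  edge_end_outer_star (or_intror erefl) (Fe _ ^~ ep) Fw.
pose D := mdist (eminus e) (eplus e).
have D0 : 0 < D by rewrite mdist_gt0; apply/eqP.
pose U := edge_interior e `|` ([set q | mdist (eminus e) q < r1] `|`
  [set q | mdist (eplus e) q < r2]).
have oball p r : open [set q : T | mdist p q < r].
  rewrite openE => q /= pq; apply/nbhs_mdistP; exists (r - mdist p q).
    by rewrite subr_gt0.
  by move=> x qx; have := metric_triangle p q x; rewrite /=; lra.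
have oU : open U.
  by apply: openU; [exact: edge_interior_open|apply: openU; exact: oball].
have eU : edge_set e `<=` U.
  move=> q eq; have [->|qm] := pselect (q = eminus e).
    by right; left; rewrite /= mdistxx.
  have [->|qp] := pselect (q = eplus e); first by right; right; rewrite /= mdistxx.
  by left.
have [d d0 dU] := edge_tube oU eU.
(* The bound [D / 4] makes the passage through [e] the shortest way between arms at different ends;
   the bound [d] makes the arms fill the ball of radius [r]. *)
pose r := Num.min (Num.min r1 r2) (Num.min (D / 4) d).
have r0 : 0 < r by rewrite !lt_min r10 r20 d0 divr_gt0.
have [rr1 rr2 rD rd] : [/\ r <= r1, r <= r2, r <= D / 4 & r <= d].
  by rewrite !ge_min !lexx !orbT.
have widen r' t : r <= r' -> 0 <= t < r -> 0 <= t < r'.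
  by move=> rr' /andP[-> tr]; exact: lt_le_trans rr'.
have dE x y s t : edge_dist e x = s -> edge_dist e y = t ->
    mdist (collapse e x) (collapse e y) = Num.min (mdist x y) (s + t).
  by move=> xs yt; rewrite collapse_dist /pre_contraction_dist xs yt.
pose arm (o : J1 + J2) t := collapse e (match o with inl k => a k t | inr k => b k t end).
exists (J1 + J2)%type, r, arm, (fun o => match o with inl k => m k | inr k => n k end).
have epm : collapse e (eplus e) = collapse e (eminus e) by apply/collapse_in_edge.
have cross k l s t : 0 <= s < r -> 0 <= t < r -> s + t <= mdist (a k s) (b l t).
  move=> sr tr.
  have : mdist (eminus e) (a k s) = s.
    have z1 : (0 : R) <= 0 < r1 by rewrite lexx.
    have := ad k k 0 s z1 (widen _ _ rr1 sr); rewrite a0 eqxx sub0r normrN => ->.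
    by rewrite ger0_norm//; case/andP: sr.
  have : mdist (b l t) (eplus e) = t.
    have z2 : (0 : R) <= 0 < r2 by rewrite lexx.
    have := bd l l t 0 (widen _ _ rr2 tr) z2; rewrite b0 eqxx subr0 => ->.
    by rewrite ger0_norm//; case/andP: tr.
  have := metric_triangle (eminus e) (a k s) (eplus e).
  have := metric_triangle (a k s) (b l t) (eplus e).
  by move: sr tr; rewrite -/D => /andP[? ?] /andP[? ?]; lra.
have near_abs s t : 0 <= s < r -> 0 <= t < r -> `|s - t| <= s + t.
  by move=> /andP[? ?] /andP[? ?]; rewrite ler_norml; apply/andP; split; lra.
split.
- split=> //.
  + by case=> k; rewrite /arm ?a0 ?b0.
  + move=> [k|k] [l|l] s t sr tr; rewrite /arm.
    * rewrite (dE _ _ s t) ?ae ?(widen r1)// ad ?(widen r1)//.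
      rewrite (inj_eq inl_inj); case: eqP => _; last by rewrite minxx.
      by rewrite min_l// near_abs.
    * rewrite (dE _ _ s t) ?ae ?be ?(widen r1)// ?(widen r2)//.
      by rewrite min_r// cross.
    * rewrite (dE _ _ s t) ?ae ?be ?(widen r1)// ?(widen r2)//.
      by rewrite min_r// metric_sym addrC cross.
    * rewrite (dE _ _ s t) ?be ?(widen r2)// bd ?(widen r2)//.
      rewrite (inj_eq inr_inj); case: eqP => _; last by rewrite minxx.
      by rewrite min_l// near_abs.
  + move=> c; have [x <-] := collapse_surj c.
    rewrite (dE _ _ 0 _ (edge_dist0 em) erefl) add0r min_r; last first.
      by rewrite metric_sym edge_dist_le.
    move=> xr; have [ex|ex] := pselect (edge_set e x).
      by left; apply/collapse_in_edge.
    have [[]//|[xr1|xr2]] := dU x (lt_le_trans xr rd).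
    * have [//|[k xk]] := ac x xr1.
      right; exists (inl k); rewrite /arm; congr collapse.
      by rewrite {2}xk ae ?mdist_ge0.
    * have [//|[k xk]] := bc x xr2.
      right; exists (inr k); rewrite /arm; congr collapse.
      by rewrite {2}xk be ?mdist_ge0.
- move=> [k|k] t tr; rewrite /arm.
    by have := fa k t (widen _ _ rr1 tr).
  by have := fb k t (widen _ _ rr2 tr); rewrite /= epm.
- by rewrite big_sumType/= opprD.
Qed.

End Contraction.

(** * Potentials and cross ratios *)

Section Potentials.
Context {R : realType} {X : metricType R}.
Hypotheses (cptX : compact [set: X]) (conX : connected [set: X])
  (starX : star_space (X := X)).
Implicit Types (p q x y z : X) (f g h : X -> R).

Lemma dipole_diag y p : dipole y y p = 0 :> R.
Proof. by rewrite /dipole subrr. Qed.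

Lemma potential_exists y z : exists g, forall p, has_sigma g p (dipole y z p).
Proof.
(* The zero function is a potential of [y] - [y]; [dipole_potential] is used against it for
   existence only. *)
have f0 p : has_sigma (fun=> 0) p (dipole y y p).
  by rewrite dipole_diag; exact: star_space_cst.
by have [g [gyz _]] := dipole_potential starX y z cptX conX f0; exists g.
Qed.

Lemma j_diag z x : j z x z = 0.
Proof.
rewrite (@jE _ _ cptX conX starX (fun=> 0)) ?subrr// => p.
by rewrite dipole_diag; exact: star_space_cst.
Qed.

(** Reciprocity between the potentials of [x] - [z] and [y] - [z]. *)
Lemma j_sym x y z : j z x y = j z y x.
Proof.
have [f fxz] := potential_exists x z.
have [g [gyz E]] := dipole_potential starX y z cptX conX fxz.
by rewrite (jE cptX conX starX _ gyz) (jE cptX conX starX _ fxz).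
Qed.

(** The potential of [a] - [q] minus that of [b] - [q] has Laplacian [a] - [b], so it is [h] up to a
    constant, and [q] disappears. *)
Lemma cross_ratioE q x z a b h : (forall p, has_sigma h p (dipole a b p)) ->
  cross_ratio q x z a b = h x - h z.
Proof.
move=> hab; have [f faq] := potential_exists a q; have [g gbq] := potential_exists b q.
rewrite /cross_ratio !(jE cptX conX starX _ faq) !(jE cptX conX starX _ gbq).
have E := has_sigma_dipole_unique cptX conX hab (g := fun w => -1 * g w + f w) _.
have {}E w : -1 * g w + f w - (-1 * g b + f b) = h w - h b.
  apply: E => p; have := has_sigma_lin (-1) (gbq p) (faq p).
  by congr has_sigma; rewrite /dipole; lra.
by have := E x; have := E z; lra.
Qed.

Lemma resistanceE a b h : (forall p, has_sigma h p (dipole a b p)) ->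
  resistance a b = h a - h b.
Proof. by move=> hab; exact: jE. Qed.

(** By the maximum principle [h] is largest at [a] and smallest at [b]. Equal values would make it
    constant, contradicting its Laplacian 1 at [a]. *)
Lemma dipole_potential_neq a b h : a <> b ->
  (forall p, has_sigma h p (dipole a b p)) -> h a != h b.
Proof.
move=> ab hab; apply/eqP => hE.
have ha x : h x <= h a.
  apply: has_sigma_le => // p; exists (dipole a b p); split => // /eqP/negPf pa.
  by rewrite /dipole pa sub0r oppr_le0.
have hb x : -1 * h x + 0 <= -1 * h b + 0.
  apply: (has_sigma_le (f := fun x => -1 * h x + 0)) => // p.
  exists (-1 * dipole a b p + 0); split.
    by apply: has_sigma_lin => //; exact: star_space_cst.
  by move=> /eqP/negPf pb; rewrite /dipole pb subr0 mulN1r addr0 oppr_le0.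
have hc : h = fun=> h a.
  by apply/funext => x; have := ha x; have := hb x; rewrite hE; lra.
have := hab a; rewrite hc => /(has_sigma_unique (star_space_cst (h a) a starX)).
rewrite /dipole eqxx; case: eqP => // _ /eqP; rewrite subr0 eq_sym oner_eq0.
by [].
Qed.

End Potentials.

(** * The contraction formula *)

Section ContractionFormula.
Context {R : realType} {T : metricType R} (e : edge_segment T).
Hypotheses (starT : star_space (X := T)) (cptT : compact [set: T])
  (conT : connected [set: T]).

(** A value of the Laplacian comes with a star, so pushing forward the zero function produces stars
    everywhere on the quotient. *)
Lemma contraction_star : star_space (X := Defs.contraction e).
Proof.
move=> c; suff [v [J [r [a [m [ca _ _]]]]]] : exists v, has_sigma (fun=> 0 : R) c v.
  by exists J, r, a.
have c0 p : has_sigma ((fun=> 0 : R) \o collapse e) p 0 := star_space_cst 0 p starT.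
have [x <-] := collapse_surj c; have [ex|ex] := pselect (edge_set e x).
  have /collapse_in_edge -> := ex.
  by exists (0 + 0); apply: has_sigma_collapse_edge.
by exists 0; exact: has_sigma_collapse_off.
Qed.

(** The maximum principle on [e] relative to its interior: only the two ends remain, where [f] takes
    the same value. *)
Lemma edge_max f : (forall p, exists v, has_sigma f p v) ->
  (forall p, edge_interior e p -> has_sigma f p 0) ->
  f (eminus e) = f (eplus e) ->
  forall x, edge_set e x -> f x <= f (eminus e).
Proof.
move=> fX f0 fE x ex; have [em ep emp] := edge_ends e.
have fc : continuous f by move=> p; have [v /has_sigma_continuous] := fX p.
have ne : edge_set e `\` edge_interior e !=set0.
  by exists (eminus e); split => // -[_ []].
have fO p : edge_interior e p -> exists2 v, has_sigma f p v & v <= 0.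
  by move=> /f0 fp; exists 0.
have [b [eb ib] fxb] := maximum_principle cptT conT fc (@edge_set_closed _ _ e)
  (edge_interior_open e starT) (fun q iq => iq.1) ne fO ex.
apply: (le_trans fxb); have [->//|bm] := pselect (b = eminus e).
by have [->|bp] := pselect (b = eplus e); [rewrite fE|case: ib].
Qed.

Lemma edge_constant f : (forall p, exists v, has_sigma f p v) ->
  (forall p, edge_interior e p -> has_sigma f p 0) ->
  f (eminus e) = f (eplus e) ->
  forall x, edge_set e x -> f x = f (eminus e).
Proof.
move=> fX f0 fE x ex; apply/le_anti; rewrite (edge_max fX)//=.
have N p v : has_sigma f p v -> has_sigma (fun x => -1 * f x + 0) p (-1 * v + 0).
  by move=> fp; apply: has_sigma_lin => //; exact: star_space_cst.
have := @edge_max (fun x => -1 * f x + 0) _ _ _ x ex; rewrite fE => H.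
suff : -1 * f x + 0 <= -1 * f (eplus e) + 0 by lra.
apply: H => // p; first by have [v /N fp] := fX p; eexists; exact: fp.
by move=> /f0/N; rewrite mulr0 addr0.
Qed.

Lemma contraction_formula x y z h :
  ~ edge_interior e y -> ~ edge_interior e z ->
  (forall p, has_sigma h p (dipole (eminus e) (eplus e) p)) ->
  j (collapse e z) (collapse e x) (collapse e y) =
  j z x y - (h x - h z) * (h y - h z) / (h (eminus e) - h (eplus e)).
Proof.
move=> iy iz hD; have [em ep emp] := edge_ends e.
have h0 : h (eminus e) - h (eplus e) != 0.
  by rewrite subr_eq0 (dipole_potential_neq cptT conT starT emp hD).
have [g [gD gE]] := dipole_potential starT y z cptT conT hD.
(* Reciprocity gives [g (eminus e) - g (eplus e) = h y - h z], so this multiple of [h] is the one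
   that equalizes [f] at the two ends. *)
pose c := (h y - h z) / (h (eminus e) - h (eplus e)).
pose f q := - c * h q + g q.
have fD p : has_sigma f p (- c * dipole (eminus e) (eplus e) p + dipole y z p).
  exact: has_sigma_lin.
have iD u v p : ~ edge_interior e u -> ~ edge_interior e v -> edge_interior e p ->
    dipole u v p = 0 :> R.
  move=> iu iv ip; rewrite /dipole; case: eqP => [pu|_]; first by rewrite pu in ip.
  by case: eqP => [pv|_]; [rewrite pv in ip|rewrite subrr].
have fe q : edge_set e q -> f q = f (eminus e).
  apply: edge_constant.
  - by move=> p; eexists; exact: fD.
  - move=> p ip; have := fD p; rewrite !iD ?mulr0 ?addr0//; first by case=> _ [].
    by case=> _ [].
  - have : c * (h (eminus e) - h (eplus e)) = g (eminus e) - g (eplus e).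
      by rewrite gE /c divfK.
    by rewrite /f; lra.
pose F (a : Defs.contraction e) := f (repr (a : {eq_quot edge_equivRel e})).
have FE : F \o collapse e = f.
  apply/funext => q; rewrite /F /=.
  have /collapse_eq[->//|[er eq]] : collapse e (repr (collapse e q)) = collapse e q.
    by rewrite /collapse reprK.
  by rewrite (fe _ er) (fe _ eq).
have cE p u : ~ edge_set e p -> (collapse e p == collapse e u) = (p == u).
  move=> ep'; apply/eqP/eqP => [/collapse_eq[//|[]//]|->//].
(* A point outside the interior of [e] collapses to the point [e] exactly when it is one of the two
   distinct ends. *)
have cE' u : ~ edge_interior e u ->
    (collapse e (eminus e) == collapse e u)%:R =
    (eminus e == u)%:R + (eplus e == u)%:R :> R.
  move=> iu; have [<-|mu] := eqVneq (eminus e) u.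
    by rewrite eqxx; case: eqP => [pm|_]; [case: emp|rewrite addr0].
  have [<-|pu] := eqVneq (eplus e) u.
    by rewrite add0r; have /collapse_in_edge -> := ep; rewrite eqxx.
  rewrite addr0; case: eqP => // /esym/collapse_in_edge eu.
  by case: iu; split => //; split; apply/eqP; rewrite eq_sym.
have FD a : has_sigma F a (dipole (collapse e y) (collapse e z) a).
  have [p <-] := collapse_surj a; have [ep'|ep'] := pselect (edge_set e p).
    have /collapse_in_edge -> := ep'.
    (* In the sum over the two ends the contributions [- c] and [c] of [h] cancel, and those of [g]
       combine into the dipole at the collapsed point. *)
    have := has_sigma_collapse_edge (F := F) starT cptT; rewrite FE.
    move=> /(_ _ _ (fD _) (fD _)); congr has_sigma.
    have /eqP/negPf mpE := emp.
    by rewrite /dipole !cE'// !eqxx (eq_sym (eplus e)) mpE /=; lra.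
  apply: has_sigma_collapse_off => //; rewrite FE; have := fD p; congr has_sigma.
  rewrite /dipole !cE//.
  have -> : (p == eminus e) = false by apply/eqP => pm; rewrite pm in ep'.
  have -> : (p == eplus e) = false by apply/eqP => pm; rewrite pm in ep'.
  by rewrite subrr mulr0 add0r.
have Fc q : F (collapse e q) = f q by rewrite -FE.
rewrite (jE (contraction_compact cptT) (contraction_connected conT)
  contraction_star _ FD).
rewrite (jE cptT conT starT _ gD) !Fc /f /c; lra.
Qed.

End ContractionFormula.

Theorem corollary8p4 (R : realType) (T : metricType R) (hT : metric_graph T)
    (e : edge_segment T) (x y z q q' : T)
    (hint : div_off_interior e x z \/ div_off_interior e y z) :
  j (collapse e z) (collapse e x) (collapse e y) =
  j z x y - cross_ratio q x z (eminus e) (eplus e) *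
            cross_ratio q' y z (eminus e) (eplus e) /
            resistance (eminus e) (eplus e).
Proof.
have [cptT conT _ charts _] := hT.
have starT : star_space (X := T).
  move=> p; have [n [r [a /star_ball_of_chart[r' _ pa]]]] := charts p.
  by exists 'I_n, r', a.
have [h hD] := potential_exists cptT conT starT (eminus e) (eplus e).
rewrite !(cross_ratioE cptT conT starT _ _ _ hD) (resistanceE cptT conT starT hD).
have cptY := contraction_compact (e := e) cptT.
have conY := contraction_connected (e := e) conT.
have starY := contraction_star (e := e) starT cptT.
(* If [x = z] or [y = z], both sides are 0. Otherwise the formula applies directly, or after [j_sym]
   has exchanged the roles of [x] and [y]. *)
case: hint => -[->|[ix iz]].
- rewrite (j_sym cptY conY starY) (j_sym cptT conT starT).
  by rewrite (j_diag cptY conY starY) (j_diag cptT conT starT) subrr !mul0r subrr.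
- rewrite (j_sym cptY conY starY) (j_sym cptT conT starT) (mulrC (h x - h z)).
  exact: contraction_formula.
- by rewrite (j_diag cptY conY starY) (j_diag cptT conT starT) subrr mulr0 mul0r subrr.
- exact: contraction_formula.
Qed.
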